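(* Let $(X,\mathscr A,\mu)$ be a $\sigma$-finite measure space, let $\phi\colon X\to X$ and $w\colon X\to\mathbb C$ be $\mathscr A$-measurable, and let the weighted composition operator $C_{\phi,w}$ in $L^2(\mu)$ be well defined. Assume that (i) for every $n\in\mathbb N$, $C_{\phi,w}^n$ is densely defined and closed. Then the following conditions are equivalent: (ii) for every $n\in\mathbb N$, $\mathsf P_{\phi,w}M_{\mathsf h_{\phi^n,w_n}}\subseteq M_{\mathsf h_{\phi^n,w_n}}\mathsf P_{\phi,w}$; (iii) for every $n\in\mathbb N$, $\mathsf E_{\phi,w}(\mathsf h_{\phi^n,w_n})=\mathsf h_{\phi^n,w_n}$ a.e. $[\mu_w]$.
   Context: $\mathbb N=\{1,2,\dots\}$. For a measurable $\psi\colon X\to X$ and a measurable $u\colon X\to\mathbb C$, put $\mu_u(\sigma)=\int_\sigma|u|^2\,d\mu$ and $\mu_u\circ\psi^{-1}(\sigma)=\mu_u(\psi^{-1}(\sigma))$ for $\sigma\in\mathscr A$. If $\mu_u\circ\psi^{-1}\ll\mu$, then the weighted composition operator $C_{\psi,u}$ is well defined by $\mathcal D(C_{\psi,u})=\{f\in L^2(\mu): u\cdot(f\circ\psi)\in L^2(\mu)\}$, $C_{\psi,u}f=u\cdot(f\circ\psi)$, and $\mathsf h_{\psi,u}\colon X\to[0,\infty]$ denotes the Radon–Nikodym derivative $d(\mu_u\circ\psi^{-1})/d\mu$. If $C_{\psi,u}$ is densely defined (equivalently $\mathsf h_{\psi,u}<\infty$ a.e. $[\mu]$), then $\mathsf E_{\psi,u}(f)$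 denotes the conditional expectation of $f$ (for $f$ measurable with values in $[0,\infty]$, or complex $f\in L^p(\mu_u)$, $1\le p\le\infty$) with respect to the $\sigma$-algebra $\psi^{-1}(\mathscr A)$ and the measure $\mu_u$. $\phi^n$ is the $n$-fold composition of $\phi$ with itself and $w_{n}=\prod_{j=0}^{n-1}w\circ\phi^j$ for $n\in\mathbb N$. When $C_{\phi,w}$ is well defined, so is $C_{\phi^n,w_n}$, and $C_{\phi,w}^n\subseteq C_{\phi^n,w_n}$, for every $n\in\mathbb N$. For a measurable function $g$ (finite a.e.), $M_g$ is the operator of multiplication by $g$ in $L^2(\mu)$ with its maximal domain $\{f\in L^2(\mu): gf\in L^2(\mu)\}$. For $f\in L^2(\mu)$, $f_w=\chi_{\{w\neq0\}}\frac fw\in L^2(\mu_w)$. $\mathsf P_{\phi,w}$ is the operator on $L^2(\mu)$ given by $\mathsf P_{\phi,w}f=w\,\mathsf E_{\phi,w}(f_w)$; it is an orthogonal projection. For operators $A,B$, $A\subseteq B$ means that $\mathcal D(A)\subseteq\mathcal D(B)$ and $Af=Bf$ for $f\in\mathcal D(A)$; products have their natural domains. *)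

(* Defs.v *)
From HB Require Import structures.
From mathcomp Require Import all_boot all_order all_algebra.
From mathcomp Require Import all_classical all_reals all_analysis.
From mathcomp Require Import measurable_realfun complex.
Set Implicit Arguments.
Unset Strict Implicit.
Unset Printing Implicit Defensive.
Import Order.TTheory GRing.Theory Num.Theory.
Import numFieldNormedType.Exports.
Local Open Scope classical_set_scope.
Local Open Scope ring_scope.

Definition cmeasurable d (X : measurableType d) (R : realType)
    (u : X -> R[i]) : Prop :=
  measurable_fun [set: X] (fun x => complex.Re (u x)) /\
  measurable_fun [set: X] (fun x => complex.Im (u x)).

Section L2.
Context d (X : measurableType d) (R : realType).
Variable mu : {measure set X -> \bar R}.

Definition L2norm (f : X -> R[i]) : \bar R :=
  Lnorm mu 2%:E (fun x => (Normc.normc (f x))%:E).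

Definition L2 : set (X -> R[i]) :=
  [set f | cmeasurable f /\ (L2norm f < +oo)%E].

(* Operators in L^2(mu) act on measurable representatives; equality in L^2(mu)
   is equality mu-a.e. *)
Record operator := Operator {
  dom : set (X -> R[i]) ;
  app : (X -> R[i]) -> X -> R[i] }.

Definition op_le (A B : operator) : Prop :=
  forall f, dom A f -> dom B f /\ (\forall x \ae mu, app A f x = app B f x).

Definition op_comp (A B : operator) : operator :=
  Operator [set f | dom B f /\ dom A (app B f)] (fun f => app A (app B f)).

Definition op_id : operator := Operator L2 id.

Definition op_pow (A : operator) (n : nat) : operator :=
  iter n (op_comp A) op_id.

Definition densely_defined (A : operator) : Prop :=
  forall f, L2 f -> forall e : R, 0 < e ->
    exists g, dom A g /\ (L2norm (fun x => f x - g x)%R < e%:E)%E.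

Definition closed_op (A : operator) : Prop :=
  forall (f_ : nat -> X -> R[i]) (f g : X -> R[i]),
    (forall k, dom A (f_ k)) -> L2 f -> L2 g ->
    (fun k => L2norm (fun x => f_ k x - f x)) @ \oo --> 0%E ->
    (fun k => L2norm (fun x => app A (f_ k) x - g x)) @ \oo --> 0%E ->
    dom A f /\ (\forall x \ae mu, app A f x = g x).

(* g is intended to be finite mu-a.e.; its infinite values are replaced by 0. *)
Definition mult_op (g : X -> \bar R) : operator :=
  let M f := fun x => (fine (g x))%:C%C * f x in
  Operator [set f | L2 f /\ L2 (M f)] M.

Definition wcomp_op (psi : X -> X) (u : X -> R[i]) : operator :=
  let C f := fun x => u x * f (psi x) in
  Operator [set f | L2 f /\ L2 (C f)] C.

Definition wmeas (u : X -> R[i]) (A : set X) : \bar R :=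
  (\int[mu]_(x in A) ((Normc.normc (u x) ^+ 2)%R)%:E)%E.

Definition wcomp_well_defined (psi : X -> X) (u : X -> R[i]) : Prop :=
  pushforward (wmeas u) psi `<< mu.

Definition wprod (phi : X -> X) (w : X -> R[i]) (n : nat) (x : X) : R[i] :=
  \prod_(j < n) w (iter j phi x).

Definition is_RN (nu : set X -> \bar R) (h : X -> \bar R) : Prop :=
  [/\ measurable_fun [set: X] h, forall x, (0 <= h x)%E &
      forall A, measurable A -> nu A = (\int[mu]_(x in A) h x)%E].

(* The library's Radon-Nikodym derivative is restricted to finite nu, while
   here nu need not even be sigma-finite and h may take the value +oo;
   h is a chosen version, unique up to a mu-null set. *)
Definition hRN (psi : X -> X) (u : X -> R[i]) : X -> \bar R :=
  xget (cst 0%E) [set h | is_RN (pushforward (wmeas u) psi) h].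

End L2.

Section wmeasure.
Context d (X : measurableType d) (R : realType).
Variables (mu : {measure set X -> \bar R}) (u : X -> R[i]).
Hypothesis cu : cmeasurable u.

Definition wmeasure of cmeasurable u : set X -> \bar R := wmeas mu u.

Local Notation nu := (wmeasure cu).

Lemma normcE (z : R[i]) :
  Normc.normc z ^+ 2 = complex.Re z ^+ 2 + complex.Im z ^+ 2.
Proof. by case: z => a b /=; rewrite sqr_sqrtr// addr_ge0 ?sqr_ge0. Qed.

Let mnormc2 : measurable_fun [set: X] (fun x => (Normc.normc (u x) ^+ 2)%:E).
Proof.
apply/measurable_EFinP.
under eq_fun do rewrite normcE.
by apply: measurable_funD; apply: measurable_funX; case: cu.
Qed.

Let nu0 : nu set0 = 0%E. Proof. exact: integral_set0. Qed.

Let nu_ge0 A : (0 <= nu A)%E.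
Proof. by apply: integral_ge0 => x _; rewrite lee_fin sqr_ge0. Qed.

Let nu_sigma_additive : semi_sigma_additive nu.
Proof.
apply: semi_sigma_additive_nng_induced => // x.
by rewrite lee_fin sqr_ge0.
Qed.

HB.instance Definition _ := isMeasure.Build _ _ _ nu
  nu0 nu_ge0 nu_sigma_additive.

End wmeasure.

Section conditional_expectation.
Context d (X : measurableType d) (R : realType).
Variables (nu : {measure set X -> \bar R}) (phi : X -> X).

(* A function on [g_sigma_algebra_preimageType phi], which is X equipped with
   the sigma-algebra of the sets [phi @^-1` A], A measurable. *)
Local Notation Xphi := (g_sigma_algebra_preimageType phi).

Definition is_condexp (f e : X -> \bar R) : Prop :=
  [/\ measurable_fun [set: Xphi] (e : Xphi -> \bar R),
      forall x, (0 <= e x)%E &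
      forall A, measurable A ->
        (\int[nu]_(x in phi @^-1` A) e x =
         \int[nu]_(x in phi @^-1` A) f x)%E].

Definition condexp (f : X -> \bar R) : X -> \bar R :=
  xget (cst 0%E) [set e | is_condexp f e].

Definition is_rcondexp (f e : X -> R) : Prop :=
  measurable_fun [set: Xphi] (e : Xphi -> R) /\
  forall A, measurable A -> (nu (phi @^-1` A) < +oo)%E ->
    nu.-integrable (phi @^-1` A) (EFin \o e) /\
    (\int[nu]_(x in phi @^-1` A) (e x)%:E =
     \int[nu]_(x in phi @^-1` A) (f x)%:E)%E.

(* For f in L^p(nu), f is integrable only on sets of finite measure, to which
   the defining identity is therefore restricted; this still determines the
   class of e when nu is sigma-finite on the sub-sigma-algebra. *)
Definition is_ccondexp (f e : X -> R[i]) : Prop :=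
  is_rcondexp (fun x => complex.Re (f x)) (fun x => complex.Re (e x)) /\
  is_rcondexp (fun x => complex.Im (f x)) (fun x => complex.Im (e x)).

Definition ccondexp (f : X -> R[i]) : X -> R[i] :=
  xget (cst 0) [set e | is_ccondexp f e].

End conditional_expectation.

Section projection.
Context d (X : measurableType d) (R : realType).
Variables (mu : {measure set X -> \bar R}) (phi : X -> X).
Variables (w : X -> R[i]) (mw : cmeasurable w).

Definition wquot (f : X -> R[i]) (x : X) : R[i] :=
  if w x != 0 then f x / w x else 0.

Definition proj_op : operator X R :=
  Operator (L2 mu) (fun f x => w x * ccondexp (wmeasure mu mw) phi (wquot f) x).

End projection.

(* Main.v *)
From HB Require Import structures.
Require Import Defs.
From mathcomp Require Import all_boot all_order all_algebra.
From mathcomp Require Import all_classical all_reals all_analysis.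
From mathcomp Require Import measurable_realfun complex.
From mathcomp Require Import ring lra.
Import Order.TTheory GRing.Theory Num.Theory.
Import numFieldNormedType.Exports.
Local Open Scope classical_set_scope.
Local Open Scope ring_scope.
Set Implicit Arguments.
Unset Strict Implicit.
Unset Printing Implicit Defensive.

(** Write nu for the measure |w|^2 mu, E for the conditional expectation with
    respect to nu and the sigma-algebra phi^-1(A), and h for h_{phi^n, w_n}. The
    equivalence holds for each n separately, because each of the two conditions
    says that h agrees nu-a.e. with a function that is measurable for
    phi^-1(A).

    For E(h) = h this is [condexp_fixP]: a function that is measurable for
    phi^-1(A) and equal to h a.e. is a conditional expectation of h, and these
    are unique up to null sets.

    For the commutation, write f = w g with g in L^2(nu); then P f = w E(g), and
    P M_h f = M_h P f becomes E(h g) = h E(g). If h is measurable for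
    phi^-1(A), it can be pulled out of E ([rcondexp_mul]). In the other
    direction one function g is enough to recover h: take g > 0 such that g and
    h g are in L^2(nu). Then E(g) > 0 a.e., so that h = E(h g) / E(g) is a
    quotient of two functions measurable for phi^-1(A) ([rcondexp_ratio]).

    Density of the domains enters twice, through the same observation
    ([dense_domain_witness]): a dense domain contains functions g_0, g_1, ...
    whose common zeros form a mu-null set. If they lie in the domain of C^n, then
    the integral of |g_k|^2 h is the integral of |w_n|^2 |g_k o phi^n|^2, which
    is finite, so h is finite a.e. ([hRN_measurable_fin]). For n = 1 a suitable
    series in the |g_k|^2 gives a positive bounded function kappa such that
    kappa o phi is nu-integrable ([pushforward_weight]). This kappa expresses
    that nu is sigma-finite on phi^-1(A), which is what E needs: with it,
    conditional expectations of L^2 functions exist ([rcondexp_exists]), contract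
    the L^2 norm ([rcondexp_contraction]) and can be tested against weights
    measurable for phi^-1(A) ([rcondexp_weight]). It also provides the test
    function g = (kappa o phi) / (1 + h) used above.

    Every change of measure along the way is an instance of
    [integral_weighted_transfer]. *)

(** * Integrals of real functions, and integrable weights *)

Lemma measurable_inv (R : realType) : measurable_fun [set: R] (@GRing.inv R).
Proof.
(* The power function gives the inverse of a nonnegative number; the square
   takes care of the sign, and of 0, whose inverse is 0 by convention. *)
have -> : @GRing.inv R = (fun x => x * (x ^+ 2) `^ (-1)).
  apply/funext => x; rewrite powR_inv1 ?sqr_ge0//.
  have [->|x0] := eqVneq x 0; first by rewrite invr0 mul0r.
  by field.
apply: measurable_funM => //.
apply: (measurableT_comp (f := fun x : R => x `^ (-1)) (g := fun x : R => x ^+ 2)).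
  exact: measurable_powR.
exact: measurable_funX.
Qed.

Lemma measurable_funV d (T : measurableType d) (R : realType) (f : T -> R) :
  measurable_fun [set: T] f -> measurable_fun [set: T] (fun x => (f x)^-1).
Proof. exact: (measurableT_comp (@measurable_inv R)). Qed.

Section real_integrals.
Context d (X : measurableType d) (R : realType) (m : {measure set X -> \bar R}).
Implicit Types (D : set X) (f g u v : X -> R).

Lemma integral_indicM D f :
  (\int[m]_x (\1_D x * f x)%:E = \int[m]_(x in D) (f x)%:E)%E.
Proof.
rewrite [RHS]integral_mkcond; apply: eq_integral => x _.
by rewrite patchE indicE; case: ifP => _; rewrite ?mul1r ?mul0r.
Qed.

Lemma integrable_le D f g : measurable D -> measurable_fun [set: X] f ->
  (forall x, `|f x| <= g x) -> m.-integrable D (EFin \o g) ->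
  m.-integrable D (EFin \o f).
Proof.
move=> mD mf fg ig; apply: le_integrable ig => //.
  by apply/measurable_EFinP; exact: measurable_funTS.
by move=> x _ /=; rewrite lee_fin (le_trans (fg x))// ler_norm.
Qed.

Lemma ge0_integrable f : measurable_fun [set: X] f -> (forall x, 0 <= f x) ->
  (\int[m]_x (f x)%:E < +oo)%E -> m.-integrable [set: X] (EFin \o f).
Proof.
move=> mf f0 foo; apply/integrableP; split; first exact/measurable_EFinP.
by under eq_integral do rewrite /= ger0_norm//.
Qed.

Lemma ge0_integral_ler f g : measurable_fun [set: X] f ->
  measurable_fun [set: X] g -> (forall x, 0 <= f x) -> (forall x, f x <= g x) ->
  (\int[m]_x (f x)%:E <= \int[m]_x (g x)%:E)%E.
Proof.
move=> mf mg f0 fg; apply: ge0_le_integral => //.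
- by move=> x _; rewrite lee_fin.
- exact/measurable_EFinP.
- exact/measurable_EFinP.
- by move=> x _; rewrite lee_fin.
Qed.

(** This passes from an identity between signed functions to one between
    nonnegative functions, after terms were moved to the other side, and back. *)
Lemma integral_eq_transfer D u v f g : measurable D ->
  m.-integrable D (EFin \o u) -> m.-integrable D (EFin \o v) ->
  m.-integrable D (EFin \o f) -> m.-integrable D (EFin \o g) ->
  (forall x, u x - v x = f x - g x) ->
  (\int[m]_(x in D) (f x)%:E = \int[m]_(x in D) (g x)%:E)%E ->
  (\int[m]_(x in D) (u x)%:E = \int[m]_(x in D) (v x)%:E)%E.
Proof.
move=> mD iu iv jf jg uvfg fg.
have : (\int[m]_(x in D) (u x - v x)%:E = \int[m]_(x in D) (f x - g x)%:E)%E.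
  by apply: eq_integral => x _; rewrite uvfg.
rewrite !integralB_EFin// fg.
have := integrable_fin_num mD iu; have := integrable_fin_num mD iv.
have := integrable_fin_num mD jg; rewrite /comp.
move=> /fineK <- /fineK <- /fineK <-.
by rewrite -!EFinB => -[] /eqP; rewrite subrr subr_eq0 => /eqP ->.
Qed.

Lemma integrable_sqr_finite_set D g : measurable D -> (m D < +oo)%E ->
  measurable_fun [set: X] g -> (\int[m]_x (g x ^+ 2)%:E < +oo)%E ->
  m.-integrable D (EFin \o g).
Proof.
move=> mD Doo mg goo.
apply: (@integrable_le D g (fun x => 1 + g x ^+ 2)) => //.
  move=> x; have := sqr_ge0 (`|g x| - 1); rewrite sqrrB1 real_normK ?num_real//.
  by have := normr_ge0 (g x); lra.
have -> : EFin \o (fun x => 1 + g x ^+ 2) =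
    (fun x => (cst 1 x)%:E + (g x ^+ 2)%:E)%E by [].
apply: integrableD => //.
  apply/integrableP; split; first exact/measurable_EFinP.
  by rewrite (eq_integral (cst 1%E)) ?integral_cst ?mul1e// => x _ /=;
    rewrite normr1.
apply: (@integrableS _ _ _ m setT) => //.
apply: (@ge0_integrable (fun x => g x ^+ 2)) => //; first exact: measurable_funX.
by move=> x; exact: sqr_ge0.
Qed.

Lemma measurable_superlevel u (r : R) : measurable_fun [set: X] u ->
  measurable [set x | r < u x].
Proof.
move=> mu; have := measurable_fun_ltr (@measurable_cst _ _ X _ setT r) mu.
by move=> /(_ measurableT [set true]); rewrite setTI; apply.
Qed.

Lemma superlevel_lty u (r : R) : measurable_fun [set: X] u ->
  (forall x, 0 <= u x) -> (\int[m]_x (u x)%:E < +oo)%E -> 0 < r ->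
  (m [set x | (r < u x)%R] < +oo)%E.
Proof.
move=> mu u0 uoo r0; have mS := measurable_superlevel r mu.
set S := [set x | r < u x] in mS *.
have : (\int[m]_(x in S) r%:E < +oo)%E.
  apply: le_lt_trans uoo.
  apply: (@le_trans _ _ (\int[m]_(x in S) (u x)%:E)%E).
    apply: ge0_le_integral => //=.
    - by move=> x _; rewrite lee_fin ltW.
    - by apply/measurable_EFinP; exact: measurable_funTS.
    - by move=> x /ltW; rewrite lee_fin.
  apply: ge0_subset_integral => //=.
  - exact/measurable_EFinP.
  - by move=> x _; rewrite lee_fin.
rewrite integral_cst//.
have := measure_ge0 m S; case: (m S) => [s _ _||//].
  exact: ltry.
by move=> _; rewrite gt0_muley ?lte_fin.
Qed.

Lemma bigcup_superlevel u : (forall x, 0 < u x) ->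
  \bigcup_n [set x | n.+1%:R^-1 < u x] = setT.
Proof.
move=> u0; apply/seteqP; split => // x _.
exists (Num.truncn (u x)^-1) => //=.
by rewrite invf_plt ?posrE//; exact: truncnS_gt.
Qed.

Lemma sigma_finite_weight u : measurable_fun [set: X] u ->
  (forall x, 0 < u x) -> (\int[m]_x (u x)%:E < +oo)%E -> sigma_finite setT m.
Proof.
move=> mu u0 uoo; exists (fun n => [set x | n.+1%:R^-1 < u x]).
  by rewrite bigcup_superlevel.
move=> n; split; first exact: measurable_superlevel.
by apply: superlevel_lty => // x; exact: ltW.
Qed.

(** The series of the functions min(u_k, 1) with coefficients
    2^-(k+1) / (1 + I_k), where I_k is the integral of u_k, is bounded by 1 both
    pointwise and in integral. *)
Lemma exists_integrable_weight (u_ : nat -> X -> R) :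
  (forall k, measurable_fun [set: X] (u_ k)) -> (forall k x, 0 <= u_ k x) ->
  (forall k, (\int[m]_x (u_ k x)%:E < +oo)%E) -> (forall x, exists k, 0 < u_ k x) ->
  exists kappa : X -> R, [/\ measurable_fun [set: X] kappa,
    forall x, 0 < kappa x, forall x, kappa x <= 1 &
    (\int[m]_x (kappa x)%:E < +oo)%E].
Proof.
move=> mu u0 uoo upos.
have I0 k : (0 <= \int[m]_x (u_ k x)%:E)%E.
  by apply: integral_ge0 => x _; rewrite lee_fin.
pose I k := fine (\int[m]_x (u_ k x)%:E).
have IE k : (\int[m]_x (u_ k x)%:E = (I k)%:E)%E.
  by rewrite fineK// ge0_fin_numE.
have Ige0 k : 0 <= I k by rewrite /I fine_ge0.
(* The 1 in the denominator keeps c k below 2^-(k+1) when I k is small. *)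
pose c k := 2^-1 ^+ k.+1 / (1 + I k) : R.
have c0 k : 0 < c k by rewrite divr_gt0 ?exprn_gt0// ltr_pwDl.
have cle k : c k <= 2^-1 ^+ k.+1.
  rewrite ler_pdivrMr ?ltr_pwDl// ler_peMr ?exprn_ge0//.
  by rewrite lerDl.
have cI k : c k * I k <= 2^-1 ^+ k.+1.
  rewrite /c mulrAC ler_pdivrMr ?ltr_pwDl// ler_wpM2l ?exprn_ge0//.
  by rewrite lerDr.
have geo : (\sum_(k <oo) (2^-1 ^+ k.+1 : R)%:E = 1)%E.
  have := @cvg_geometric_eseries_half R 1 0.
  rewrite expr0 divr1 => /cvg_lim <-//.
  congr (limn _); apply/funext => n /=.
  by apply: eq_bigr => i _; rewrite addn1 mul1r exprVn natrX.
pose t k x := c k * Num.min (u_ k x) 1.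
have t0 k x : 0 <= t k x by rewrite mulr_ge0 ?le_min ?u0 ?ler01// ltW.
have mt k : measurable_fun setT (t k).
  by apply: measurable_funM => //; exact: measurable_minr.
pose K x := (\sum_(k <oo) (t k x)%:E)%E.
have K0 x : (0 <= K x)%E by apply: nneseries_ge0 => k _ _; rewrite lee_fin.
have K1 x : (K x <= 1)%E.
  rewrite -geo; apply: lee_nneseries => [k _ _|k _]; first by rewrite lee_fin.
  rewrite lee_fin (le_trans _ (cle k))// ler_piMr ?ge_min ?lexx ?orbT//.
  exact: ltW.
have Kfin x : K x \is a fin_num.
  by rewrite ge0_fin_numE// (le_lt_trans (K1 x)) ?ltry.
have mK : measurable_fun setT K.
  apply: ge0_emeasurable_sum => [k x _ _|k _]; first by rewrite lee_fin.
  exact/measurable_EFinP.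
exists (fine \o K); split.
- exact: measurableT_comp.
- move=> x; rewrite fine_gt0// -ge0_fin_numE// Kfin andbT.
  have [k uk] := upos x.
  apply: (@lt_le_trans _ _ (t k x)%:E).
    by rewrite lte_fin mulr_gt0// lt_min uk ltr01.
  rewrite /K (nneseries_split 0%N k.+1)//; last by move=> *; rewrite lee_fin.
  rewrite add0n.
  apply: (@le_trans _ _ (\sum_(0 <= i < k.+1) (t i x)%:E)%E).
    rewrite big_nat_recr//= leeDr// sume_ge0// => i _; by rewrite lee_fin.
  by rewrite leeDl// nneseries_ge0// => *; rewrite lee_fin.
- by move=> x; rewrite -lee_fin fineK.
- under eq_integral do rewrite /= fineK//.
  rewrite /K integral_nneseries//; last 2 first.
  + by move=> k; apply/measurable_EFinP.
  + by move=> k x _; rewrite lee_fin.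
  apply: (@le_lt_trans _ _ 1%E); last exact: ltry.
  rewrite -geo; apply: lee_nneseries => [k _ _|k _].
    by apply: integral_ge0 => x _; rewrite lee_fin.
  apply: (@le_trans _ _ (\int[m]_x ((c k)%:E * (u_ k x)%:E))%E).
    apply: ge0_le_integral => //.
    + by move=> x _; rewrite lee_fin.
    + exact/measurable_EFinP.
    + by apply/measurable_EFinP; apply: measurable_funM.
    + move=> x _; rewrite -EFinM lee_fin ler_wpM2l ?ge_min ?lexx//.
      exact: ltW.
  rewrite ge0_integralZl_EFin//.
  + by rewrite IE -EFinM lee_fin.
  + by move=> x _; rewrite lee_fin.
  + exact/measurable_EFinP.
  + exact: ltW.
Qed.

End real_integrals.

(** * Image densities and Radon-Nikodym derivatives *)

Section weighted_transfer.
Context dY (Y : measurableType dY) (R : realType).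
Local Open Scope ereal_scope.
Import HBNNSimple.

(** The right-hand side sees g only through its integrals over sets of the form
    p^-1(B): this is why [integral_weighted_transfer] holds. *)
Lemma integral_weighted_approx d (X : measurableType d)
    (m : {measure set X -> \bar R}) (p : X -> Y) (g : X -> \bar R)
    (k : Y -> \bar R) (mk : measurable_fun [set: Y] k) :
  measurable_fun [set: X] p -> measurable_fun [set: X] g ->
  (forall x, 0 <= g x) -> (forall y, 0 <= k y) ->
  \int[m]_x (k (p x) * g x) =
  limn (fun n => \sum_(r \in range (nnsfun_approx measurableT mk n))
    r%:E * \int[m]_(x in p @^-1` (nnsfun_approx measurableT mk n @^-1` [set r])) g x).
Proof.
move=> mp mg g0 k0; set h := nnsfun_approx measurableT mk.
have kh x : k (p x) * g x = limn (fun n => (h n (p x))%:E * g x).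
  apply/esym/cvg_lim => //.
  have hk : (h n (p x))%:E @[n --> \oo] --> k (p x).
    by apply: cvg_nnsfun_approx => // y _.
  (* The product of 0 and +oo is 0, so the limit of a product needs care when
     one of the factors vanishes. *)
  have [k_0|kn0] := eqVneq (k (p x)) 0.
    rewrite k_0 mul0e; apply: cvg_near_cst; apply: nearW => n.
    suff -> : h n (p x) = 0%R by rewrite mul0e.
    apply/eqP; rewrite eq_le; apply/andP; split; last exact: fun_ge0.
    rewrite -lee_fin; apply: (@le_trans _ _ (k (p x))); last by rewrite k_0.
    by rewrite /h nnsfun_approxE; apply: le_approx => // y _.
  have [->|gn0] := eqVneq (g x) 0.
    by rewrite mule0; apply: cvg_near_cst; apply: nearW => n; rewrite mule0.
  apply: cvgeM => //; last exact: cvg_cst.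
  by apply: neq0_mule_def; rewrite mule_eq0 negb_or kn0 gn0.
under eq_integral do rewrite kh.
have mpre r n : measurable (p @^-1` (h n @^-1` [set r])).
  rewrite -[X in measurable X]setTI; apply: mp => //.
rewrite monotone_convergence//; last 3 first.
- move=> n; apply: emeasurable_funM => //; apply/measurable_EFinP.
  exact: measurableT_comp.
- by move=> n x _; rewrite mule_ge0 ?lee_fin.
- move=> x _ a b ab; rewrite lee_wpmul2r ?lee_fin//.
  exact/lefP/nd_nnsfun_approx.
congr (limn _); apply/funext => n.
under eq_integral => x _.
  rewrite fimfunE -fsumEFin// ge0_mule_fsuml; last first.
    by move=> r; exact: nnfun_muleindic_ge0.
  over.
have mind r : measurable_fun [set: Y] (\1_(h n @^-1` [set r]) : Y -> R).
  exact: measurable_indic.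
have mi r : measurable_fun [set: X] (fun x => (r * \1_(h n @^-1` [set r]) (p x))%:E).
  apply/measurable_EFinP; apply: measurable_funM => //.
  exact: (measurableT_comp (mind r)).
rewrite ge0_integral_fsum//; last 2 first.
- by move=> r; apply: emeasurable_funM.
- by move=> r x _; rewrite mule_ge0//; exact: nnfun_muleindic_ge0.
apply: eq_fsbigr => r; rewrite inE => -[y _ hr].
have r0 : (0 <= r)%R by rewrite -hr.
under eq_integral do rewrite EFinM -muleA.
rewrite ge0_integralZl_EFin//; last 2 first.
- by move=> x _; rewrite mule_ge0// lee_fin.
- apply: emeasurable_funM => //; apply/measurable_EFinP.
  exact: (measurableT_comp (mind r)).
congr (_ * _); rewrite [RHS]integral_mkcond; apply: eq_integral => x _.
rewrite patchE indicE.
have -> : (p x \in h n @^-1` [set r]) = (x \in p @^-1` (h n @^-1` [set r])).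
  by apply/idP/idP; rewrite !inE.
by case: ifP => _; rewrite ?mul1e ?mul0e.
Qed.

(** Two weights g1, g2 that give the same mass to all p1^-1(B) and p2^-1(B)
    have the same integrals against all k o p1 and k o p2. With identities,
    constants or a map to a coarser sigma-algebra for the p's and g's, this covers
    image measures, measures with a density, and conditional expectations. *)
Lemma integral_weighted_transfer d1 d2 (X1 : measurableType d1)
    (X2 : measurableType d2) (m1 : {measure set X1 -> \bar R})
    (m2 : {measure set X2 -> \bar R}) (p1 : X1 -> Y) (p2 : X2 -> Y)
    (g1 : X1 -> \bar R) (g2 : X2 -> \bar R) (k : Y -> \bar R) :
  measurable_fun [set: X1] p1 -> measurable_fun [set: X2] p2 ->
  measurable_fun [set: X1] g1 -> measurable_fun [set: X2] g2 ->
  (forall x, 0 <= g1 x) -> (forall x, 0 <= g2 x) ->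
  (forall B, measurable B ->
    \int[m1]_(x in p1 @^-1` B) g1 x = \int[m2]_(x in p2 @^-1` B) g2 x) ->
  measurable_fun [set: Y] k -> (forall y, 0 <= k y) ->
  \int[m1]_x (k (p1 x) * g1 x) = \int[m2]_x (k (p2 x) * g2 x).
Proof.
move=> mp1 mp2 mg1 mg2 g10 g20 g12 mk k0.
rewrite !(integral_weighted_approx _ mk)//; congr (limn _).
by apply/funext => n; apply: eq_fsbigr => r _; rewrite g12.
Qed.

End weighted_transfer.

Section image_density.
Context d dY (X : measurableType d) (Y : measurableType dY) (R : realType).
Variables (m : {measure set X -> \bar R}) (p : X -> Y).
Hypothesis mp : measurable_fun [set: X] p.

Lemma image_density_measure (f : X -> \bar R) :
  measurable_fun [set: X] f -> (forall x, 0 <= f x)%E ->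
  exists M : {measure set Y -> \bar R},
    forall A, M A = (\int[m]_(x in p @^-1` A) f x)%E.
Proof.
move=> mf f0.
pose M (A : set Y) := (\int[m]_(x in p @^-1` A) f x)%E.
have M0 : M set0 = 0%E by rewrite /M preimage_set0 integral_set0.
have Mge0 A : (0 <= M A)%E by apply: integral_ge0.
have mpre A : measurable A -> measurable (p @^-1` A).
  by move=> mA; rewrite -[X in measurable X]setTI; exact: mp.
have Msa : semi_sigma_additive M.
  move=> F mF tF mUF; rewrite /M preimage_bigcup.
  apply: (semi_sigma_additive_nng_induced mf f0).
  - by move=> n; exact: mpre.
  - apply/trivIsetP => /= i j _ _ ij; rewrite -preimage_setI.
    by move/trivIsetP : tF => /(_ _ _ _ _ ij) ->//; rewrite preimage_set0.
  - by rewrite -preimage_bigcup; exact: mpre.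
by exists (HB.pack_for {measure set Y -> \bar R} M
  (isMeasure.Build _ _ _ M M0 Mge0 Msa)).
Qed.

Lemma integral_image_density (M : {measure set Y -> \bar R}) (f : X -> R)
    (k : Y -> R) :
  measurable_fun [set: X] f -> (forall x, 0 <= f x) ->
  (forall A, measurable A -> M A = \int[m]_(x in p @^-1` A) (f x)%:E)%E ->
  measurable_fun [set: Y] k -> (forall x, 0 <= k x) ->
  (\int[M]_x (k x)%:E = \int[m]_x (k (p x) * f x)%:E)%E.
Proof.
move=> mf f0 ME mk k0.
have -> : (\int[M]_x (k x)%:E = \int[M]_x ((EFin \o k) (id x) * cst 1 x))%E.
  by apply: eq_integral => x _; rewrite /= mule1.
have -> : (\int[m]_x (k (p x) * f x)%:E =
    \int[m]_x ((EFin \o k) (p x) * (EFin \o f) x))%E.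
  by apply: eq_integral => x _; rewrite /= EFinM.
apply: integral_weighted_transfer => //.
- exact/measurable_EFinP.
- by move=> B mB; rewrite integral_cst// mul1e -[LHS]/(M B) ME.
- exact/measurable_EFinP.
Qed.

End image_density.

Lemma radon_nikodym_real d (X : measurableType d) (R : realType)
    (la m : {measure set X -> \bar R}) :
  sigma_finite setT la -> (m setT < +oo)%E -> m `<< la ->
  exists G : X -> R, [/\ measurable_fun [set: X] G, forall x, 0 <= G x &
    forall A, measurable A -> m A = (\int[la]_(x in A) (G x)%:E)%E].
Proof.
move=> sla moo mla.
have fm : fin_num_fun m.
  move=> A mA; rewrite ge0_fin_numE//; apply: le_lt_trans moo.
  by apply: le_measure; rewrite ?inE.
pose S1 := isSFinite.Build _ _ _ _ (sfinite_measure_sigma_finite sla).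
pose S2 := isSigmaFinite.Build _ _ _ _ sla.
pose la' := HB.pack_for (SigmaFiniteMeasure.type X R) (Measure.sort la) S1 S2.
have sm : sigma_finite setT m.
  by apply: fin_num_fun_sigma_finite => //; rewrite measure0.
pose H1 := isFinite.Build _ _ _ _ fm.
pose H2 := isSFinite.Build _ _ _ _ (sfinite_measure_sigma_finite sm).
pose H3 := isSigmaFinite.Build _ _ _ _ sm.
pose m' := HB.pack_for (FiniteMeasure.type X R) (Measure.sort m) H1 H2 H3.
have [f [f0 ffin /integrableP[mf _] fE]] :=
  @radon_nikodym_sigma_finite _ _ _ la' m' mla.
exists (fine \o f); split.
- exact: measurableT_comp.
- by move=> x; exact: fine_ge0.
- by move=> A mA; rewrite [LHS]fE//; apply: eq_integral => x _; rewrite /= fineK.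
Qed.

(** * The sigma-algebra of preimages *)

Section preimage_sigma_algebra.
Context d (X : measurableType d) (phi : X -> X).
Hypothesis mphi : measurable_fun [set: X] phi.
Local Notation Xphi := (g_sigma_algebra_preimageType phi).

Lemma measurable_preimageT (B : set Xphi) : measurable B ->
  exists2 A : set X, measurable A & B = phi @^-1` A.
Proof. by move=> [A mA <-]; exists A => //; rewrite setTI. Qed.

Lemma preimage_measurable (A : set X) : measurable A ->
  measurable (phi @^-1` A : set Xphi).
Proof. by move=> mA; exists A => //; rewrite setTI. Qed.

Lemma measurable_coarser (B : set Xphi) : measurable B -> measurable (B : set X).
Proof.
by move=> [A mA <-]; apply: mphi.
Qed.

(** It is the type that matters here: integrals over X of functions measurable for
    phi^-1(A) become transfers along this map. *)
Definition coarsen : X -> Xphi := id.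

Lemma measurable_coarsen : measurable_fun [set: X] coarsen.
Proof. by move=> _ B mB; rewrite setTI; exact: measurable_coarser. Qed.

Lemma measurable_fun_coarser d' (T : measurableType d') (f : X -> T) :
  measurable_fun [set: Xphi] (f : Xphi -> T) -> measurable_fun [set: X] f.
Proof. by move=> mf; exact: (measurableT_comp mf measurable_coarsen). Qed.

Lemma measurable_fun_preimage d' (T : measurableType d') (f : X -> T) :
  measurable_fun [set: X] f -> measurable_fun [set: Xphi] (f \o phi : Xphi -> T).
Proof.
move=> mf _ B mB; rewrite setTI comp_preimage; apply: preimage_measurable.
by rewrite -[X in measurable X]setTI; exact: mf.
Qed.

End preimage_sigma_algebra.

(** * Conditional expectation with respect to the preimage sigma-algebra *)

Section preimage_condexp.
Context d (X : measurableType d) (R : realType).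
Variables (nu : {measure set X -> \bar R}) (phi : X -> X) (kappa : X -> R).
Hypothesis mphi : measurable_fun [set: X] phi.
Hypothesis mkappa : measurable_fun [set: X] kappa.
Hypothesis kappa0 : forall x, 0 < kappa x.
Hypothesis kappa1 : forall x, kappa x <= 1.
Hypothesis ikappa : (\int[nu]_x (kappa (phi x))%:E < +oo)%E.
Local Notation Xphi := (g_sigma_algebra_preimageType phi).
Implicit Types (e g k a : X -> R).

Let mk : measurable_fun [set: X] (kappa \o phi).
Proof. exact: measurableT_comp. Qed.

Let mkphi : measurable_fun [set: Xphi] (kappa \o phi : Xphi -> R).
Proof. exact: measurable_fun_preimage. Qed.

Let mX (f : X -> R) : measurable_fun [set: Xphi] (f : Xphi -> R) ->
  measurable_fun [set: X] f.
Proof. exact: measurable_fun_coarser. Qed.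

Let mpre A : measurable A -> measurable (phi @^-1` A).
Proof. by move=> mA; rewrite -[X in measurable X]setTI; exact: mphi. Qed.

Lemma integral_preimage_weight (f1 f2 : X -> \bar R) (k : X -> \bar R) :
  measurable_fun [set: X] f1 -> measurable_fun [set: X] f2 ->
  (forall x, 0 <= f1 x)%E -> (forall x, 0 <= f2 x)%E ->
  (forall A, measurable A -> \int[nu]_(x in phi @^-1` A) f1 x =
                             \int[nu]_(x in phi @^-1` A) f2 x)%E ->
  measurable_fun [set: Xphi] (k : Xphi -> \bar R) -> (forall x, 0 <= k x)%E ->
  (\int[nu]_x (k x * f1 x) = \int[nu]_x (k x * f2 x))%E.
Proof.
move=> mf1 mf2 f10 f20 f12 mk' k0.
apply: (@integral_weighted_transfer _ Xphi R _ _ X X nu nu (@coarsen _ _ phi)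
  (@coarsen _ _ phi)) => //; try exact: measurable_coarsen.
by move=> B [A mA <-]; rewrite setTI; exact: f12.
Qed.

Let pos (t : R) := Num.max t 0.
Let neg (t : R) := Num.max (- t) 0.

Let posnegE t : pos t - neg t = t.
Proof. rewrite /pos /neg /Num.max; case: ifPn; case: ifPn; lra. Qed.

Let posnegD t : pos t + neg t = `|t|.
Proof.
rewrite /pos /neg /Num.max; case: ifPn; case: ifPn => ? ?;
  case: (ger0P t); lra.
Qed.

Let pos0 t : 0 <= pos t. Proof. by rewrite le_max lexx orbT. Qed.

Let neg0 t : 0 <= neg t. Proof. by rewrite le_max lexx orbT. Qed.

Let mpos g : measurable_fun [set: X] g -> measurable_fun [set: X] (pos \o g).
Proof. by move=> mg; exact: measurable_maxr. Qed.

Let mneg g : measurable_fun [set: X] g -> measurable_fun [set: X] (neg \o g).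
Proof. by move=> mg; apply: measurable_maxr => //; exact: measurableT_comp. Qed.

(** Sets of finite measure that exhaust phi^-1(A). *)
Let F (A : set X) n := phi @^-1` (A `&` [set x | n.+1%:R^-1 < kappa x]).

Let mF A n : measurable A -> measurable (F A n).
Proof.
move=> mA; rewrite -[X in measurable X]setTI; apply: mphi => //.
by apply: measurableI => //; exact: measurable_superlevel.
Qed.

Let F_lty A n : measurable A -> (nu (F A n) < +oo)%E.
Proof.
move=> mA; have k0 x : 0 <= (kappa \o phi) x by exact/ltW/kappa0.
have n0 : 0 < n.+1%:R^-1 :> R by rewrite invr_gt0.
apply: le_lt_trans (superlevel_lty mk k0 ikappa n0).
apply: le_measure; rewrite ?inE; [exact: mF|exact: measurable_superlevel|].
by move=> x [].
Qed.

Let bigcup_F A : phi @^-1` A = \bigcup_n F A n.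
Proof.
by rewrite -preimage_bigcup -setI_bigcupr bigcup_superlevel// setIT.
Qed.

Let nd_F A : nondecreasing_seq (F A).
Proof.
move=> i j ij; apply/subsetPset => x [Ax /= h]; split => //=.
by apply: le_lt_trans h; rewrite lef_pV2 ?posrE// ler_nat.
Qed.

(** With g = pos g - neg g and e = pos e - neg e, moving the negative parts to
    the other side turns the identity between g and e into one between nonnegative
    functions, which holds on every set of phi^-1(A), of finite measure or not. *)
Let parts_eq g e A : measurable_fun [set: X] g ->
  (\int[nu]_x (g x ^+ 2)%:E < +oo)%E -> is_rcondexp nu phi g e -> measurable A ->
  (\int[nu]_(x in phi @^-1` A) (pos (g x) + neg (e x))%:E =
   \int[nu]_(x in phi @^-1` A) (neg (g x) + pos (e x))%:E)%E.
Proof.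
move=> mg goo [/mX me ege] mA.
have m1 : measurable_fun [set: X] (fun x => pos (g x) + neg (e x)).
  by apply: measurable_funD; [exact: mpos|exact: mneg].
have m2 : measurable_fun [set: X] (fun x => neg (g x) + pos (e x)).
  by apply: measurable_funD; [exact: mneg|exact: mpos].
(* The definition of e gives the identity on sets of finite measure such as
   F A n; both sides pass to the limit by monotone convergence. *)
suff FE n : (\int[nu]_(x in F A n) (pos (g x) + neg (e x))%:E =
             \int[nu]_(x in F A n) (neg (g x) + pos (e x))%:E)%E.
  rewrite bigcup_F.
  have cvgF (f : X -> R) : measurable_fun [set: X] f -> (forall x, 0 <= f x) ->
      (\int[nu]_(x in F A n) (f x)%:E @[n --> \oo] -->
       \int[nu]_(x in \bigcup_n F A n) (f x)%:E)%E.
    move=> mf f0; apply: ge0_nondecreasing_set_cvg_integral.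
    - exact: nd_F.
    - by move=> i; exact: mF.
    - by move=> i; apply: measurable_funTS; exact/measurable_EFinP.
    - by move=> i x _; rewrite lee_fin.
  have c1 := cvgF _ m1 (fun x => addr_ge0 (pos0 (g x)) (neg0 (e x))).
  have c2 := cvgF _ m2 (fun x => addr_ge0 (neg0 (g x)) (pos0 (e x))).
  rewrite -(cvg_lim _ c1)// -(cvg_lim _ c2)//; congr (limn _).
  by apply/funext => n; exact: FE.
have mFn := @mF A n mA.
have [|ie ee] := ege (A `&` [set x | n.+1%:R^-1 < kappa x]) _ (F_lty n mA).
  by apply: measurableI => //; exact: measurable_superlevel.
have ig := integrable_sqr_finite_set mFn (F_lty n mA) mg goo.
have iabs : nu.-integrable (F A n) (EFin \o (fun x => `|g x| + `|e x|)).
  have -> : EFin \o (fun x => `|g x| + `|e x|) =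
      (fun x => (`|g x|)%:E + (`|e x|)%:E)%E by [].
  by apply: integrableD => //; exact: integrable_norm.
apply: (@integral_eq_transfer _ _ _ _ _ _ _ g e) => //.
- apply: integrable_le iabs => // x.
  rewrite ger0_norm ?addr_ge0// -!posnegD.
  by have := neg0 (g x); have := pos0 (e x); lra.
- apply: integrable_le iabs => // x.
  rewrite ger0_norm ?addr_ge0// -!posnegD.
  by have := pos0 (g x); have := neg0 (e x); lra.
- move=> x; rewrite -[in RHS](posnegE (g x)) -[in RHS](posnegE (e x)); ring.
Qed.

Let weight_eq g e k : measurable_fun [set: X] g ->
  (\int[nu]_x (g x ^+ 2)%:E < +oo)%E -> is_rcondexp nu phi g e ->
  measurable_fun [set: Xphi] (k : Xphi -> R) -> (forall x, 0 <= k x) ->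
  (\int[nu]_x (k x * (pos (g x) + neg (e x)))%:E =
   \int[nu]_x (k x * (neg (g x) + pos (e x)))%:E)%E.
Proof.
move=> mg goo ge mk' k0; have me := mX ge.1.
have := @integral_preimage_weight (EFin \o (fun x => pos (g x) + neg (e x)))
  (EFin \o (fun x => neg (g x) + pos (e x))) (EFin \o k).
apply.
- by apply/measurable_EFinP; apply: measurable_funD; [exact: mpos|exact: mneg].
- by apply/measurable_EFinP; apply: measurable_funD; [exact: mneg|exact: mpos].
- by move=> x; rewrite lee_fin addr_ge0.
- by move=> x; rewrite lee_fin addr_ge0.
- by move=> A mA; exact: parts_eq.
- exact/measurable_EFinP.
- by move=> x; rewrite lee_fin.
Qed.

(** The identity [weight_eq], used with k restricted to {e >= 0} and to {e < 0},
    bounds the two parts of e by parts of g; once everything is integrable, it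
    gives the equality. *)
Lemma rcondexp_weight g e k : measurable_fun [set: X] g ->
  (\int[nu]_x (g x ^+ 2)%:E < +oo)%E -> is_rcondexp nu phi g e ->
  measurable_fun [set: Xphi] (k : Xphi -> R) -> (forall x, 0 <= k x) ->
  (\int[nu]_x (k x * `|g x|)%:E < +oo)%E ->
  [/\ (\int[nu]_x (k x * `|e x|)%:E <= \int[nu]_x (k x * `|g x|)%:E)%E,
      nu.-integrable [set: X] (EFin \o (fun x => k x * e x)) &
      (\int[nu]_x (k x * e x)%:E = \int[nu]_x (k x * g x)%:E)%E].
Proof.
move=> mg goo ge mkk k0 kgoo; have me := mX ge.1; have mkX := mX mkk.
have mb : measurable_fun [set: Xphi] (fun x => 0 <= e x).
  by apply: measurable_fun_ler => //; exact: ge.1.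
pose k1 x := if 0 <= e x then k x else 0.
pose k2 x := if 0 <= e x then 0 else k x.
have mk1 : measurable_fun [set: Xphi] (k1 : Xphi -> R).
  exact: measurable_fun_ifT.
have mk2 : measurable_fun [set: Xphi] (k2 : Xphi -> R).
  exact: measurable_fun_ifT.
have k10 x : 0 <= k1 x by rewrite /k1; case: ifP.
have k20 x : 0 <= k2 x by rewrite /k2; case: ifP.
have eq1 := weight_eq mg goo ge mk1 k10.
have eq2 := weight_eq mg goo ge mk2 k20.
have mgp := mpos mg. have mgn := mneg mg.
have mep := mpos me. have men := mneg me.
(* Where e is nonnegative its negative part vanishes, so eq1 bounds k * pos e. *)
have le1 : (\int[nu]_x (k x * pos (e x))%:E <= \int[nu]_x (k1 x * pos (g x))%:E)%E.
  apply: (@le_trans _ _ (\int[nu]_x (k1 x * (neg (g x) + pos (e x)))%:E)%E).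
    apply: ge0_integral_ler.
    - exact: measurable_funM.
    - by apply: measurable_funM; [exact: mX|exact: measurable_funD].
    - by move=> x; rewrite mulr_ge0.
    - move=> x; rewrite /k1; case: ifPn => [ep|en].
        by rewrite ler_wpM2l// lerDr.
      have -> : pos (e x) = 0.
        by rewrite /pos; apply/max_idPr; rewrite ltW// ltNge.
      by rewrite mulr0 mul0r.
  rewrite -eq1; apply: ge0_integral_ler.
  - by apply: measurable_funM; [exact: mX|exact: measurable_funD].
  - by apply: measurable_funM => //; exact: mX.
  - by move=> x; rewrite mulr_ge0// addr_ge0.
  - move=> x; rewrite /k1; case: ifPn => [ep|en]; last by rewrite !mul0r.
    have -> : neg (e x) = 0 by rewrite /neg; apply/max_idPr; rewrite oppr_le0.
    by rewrite addr0.
have le2 : (\int[nu]_x (k x * neg (e x))%:E <= \int[nu]_x (k2 x * neg (g x))%:E)%E.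
  apply: (@le_trans _ _ (\int[nu]_x (k2 x * (pos (g x) + neg (e x)))%:E)%E).
    apply: ge0_integral_ler.
    - exact: measurable_funM.
    - by apply: measurable_funM; [exact: mX|exact: measurable_funD].
    - by move=> x; rewrite mulr_ge0.
    - move=> x; rewrite /k2; case: ifPn => [ep|en]; last first.
        by rewrite ler_wpM2l// lerDr.
      have -> : neg (e x) = 0 by rewrite /neg; apply/max_idPr; rewrite oppr_le0.
      by rewrite mulr0 mul0r.
  rewrite eq2; apply: ge0_integral_ler.
  - by apply: measurable_funM; [exact: mX|exact: measurable_funD].
  - by apply: measurable_funM => //; exact: mX.
  - by move=> x; rewrite mulr_ge0// addr_ge0.
  - move=> x; rewrite /k2; case: ifPn => [ep|en]; first by rewrite !mul0r.
    have -> : pos (e x) = 0.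
      by rewrite /pos; apply/max_idPr; rewrite ltW// ltNge.
    by rewrite addr0.
have le3 : (\int[nu]_x (k x * `|e x|)%:E <= \int[nu]_x (k x * `|g x|)%:E)%E.
  under eq_integral do rewrite -posnegD mulrDr EFinD.
  rewrite ge0_integralD//; last 4 first.
  - by move=> x _; rewrite lee_fin mulr_ge0.
  - by apply/measurable_EFinP; exact: measurable_funM.
  - by move=> x _; rewrite lee_fin mulr_ge0.
  - by apply/measurable_EFinP; exact: measurable_funM.
  apply: (le_trans (leeD le1 le2)).
  rewrite -ge0_integralD//; last 4 first.
  - by move=> x _; rewrite lee_fin mulr_ge0.
  - by apply/measurable_EFinP; apply: measurable_funM => //; exact: mX.
  - by move=> x _; rewrite lee_fin mulr_ge0.
  - by apply/measurable_EFinP; apply: measurable_funM => //; exact: mX.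
  under eq_integral do rewrite -EFinD.
  apply: ge0_integral_ler.
  - by apply: measurable_funD; apply: measurable_funM => //; exact: mX.
  - by apply: measurable_funM => //; exact: measurableT_comp.
  - by move=> x; rewrite addr_ge0// mulr_ge0.
  - move=> x; rewrite -posnegD /k1 /k2; case: ifP => _; rewrite mul0r.
      by rewrite addr0 ler_wpM2l// lerDl.
    by rewrite add0r ler_wpM2l// lerDr.
have ikg : nu.-integrable [set: X] (EFin \o (fun x => k x * `|g x|)).
  apply: ge0_integrable => //; last by move=> x; rewrite mulr_ge0.
  by apply: measurable_funM => //; exact: measurableT_comp.
have ike : nu.-integrable [set: X] (EFin \o (fun x => k x * `|e x|)).
  apply: ge0_integrable => //; last exact: le_lt_trans le3 _.
    by apply: measurable_funM => //; exact: measurableT_comp.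
  by move=> x; rewrite mulr_ge0.
have isum : nu.-integrable [set: X] (EFin \o (fun x => k x * (`|g x| + `|e x|))).
  have -> : EFin \o (fun x => k x * (`|g x| + `|e x|)) =
      (fun x => (k x * `|g x|)%:E + (k x * `|e x|)%:E)%E.
    by apply/funext => x /=; rewrite mulrDr EFinD.
  exact: integrableD.
have ike' : nu.-integrable [set: X] (EFin \o (fun x => k x * e x)).
  apply: integrable_le ike => //; first exact: measurable_funM.
  by move=> x; rewrite normrM ger0_norm.
split => //.
apply: (@integral_eq_transfer _ _ _ _ _ _ _ (fun x => k x * (neg (g x) + pos (e x)))
   (fun x => k x * (pos (g x) + neg (e x)))) => //.
- apply: integrable_le ikg => //; first exact: measurable_funM.
  by move=> x; rewrite normrM ger0_norm.
- apply: integrable_le isum => //.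
    by apply: measurable_funM => //; exact: measurable_funD.
  move=> x; rewrite ger0_norm ?mulr_ge0 ?addr_ge0// ler_wpM2l// -!posnegD.
  by have := pos0 (g x); have := neg0 (e x); lra.
- apply: integrable_le isum => //.
    by apply: measurable_funM => //; exact: measurable_funD.
  move=> x; rewrite ger0_norm ?mulr_ge0 ?addr_ge0// ler_wpM2l// -!posnegD.
  by have := neg0 (g x); have := pos0 (e x); lra.
- move=> x; rewrite -[in LHS](posnegE (g x)) -[in LHS](posnegE (e x)); ring.
- by apply/esym; exact: weight_eq.
Qed.

(** Since kappa^2 <= kappa, the bound on k makes it square integrable. *)
Let weight_sqr_lty g k (c : R) : measurable_fun [set: X] g ->
  measurable_fun [set: X] k -> 0 <= c -> (forall x, 0 <= k x) ->
  (forall x, k x <= c * kappa (phi x)) ->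
  (\int[nu]_x (g x ^+ 2)%:E < +oo)%E -> (\int[nu]_x (k x * `|g x|)%:E < +oo)%E.
Proof.
move=> mg mk' c0 k0 kk goo.
apply: (@le_lt_trans _ _ (\int[nu]_x (c ^+ 2 * kappa (phi x) + g x ^+ 2)%:E)%E).
  apply: ge0_integral_ler => //.
  - by apply: measurable_funM => //; exact: measurableT_comp.
  - by apply: measurable_funD; [exact: measurable_funM|exact: measurable_funX].
  - by move=> x; rewrite mulr_ge0.
  - move=> x; have := sqr_ge0 (k x - `|g x|).
    have : k x ^+ 2 <= c ^+ 2 * kappa (phi x).
      apply: (@le_trans _ _ ((c * kappa (phi x)) ^+ 2)).
        by rewrite ler_sqr ?nnegrE// (le_trans (k0 x)).
      by rewrite exprMn ler_wpM2l ?sqr_ge0// expr2 ler_piMl// ltW.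
    rewrite sqrrB real_normK ?num_real// -mulr_natl.
    have := mulr_ge0 (k0 x) (normr_ge0 (g x)); lra.
under eq_integral do rewrite EFinD.
rewrite ge0_integralD//; last 4 first.
- by move=> x _; rewrite lee_fin mulr_ge0 ?sqr_ge0// ltW.
- by apply/measurable_EFinP; exact: measurable_funM.
- by move=> x _; rewrite lee_fin sqr_ge0.
- by apply/measurable_EFinP; exact: measurable_funX.
rewrite lte_add_pinfty//.
under eq_integral do rewrite EFinM.
rewrite ge0_integralZl_EFin ?sqr_ge0//; last 2 first.
- by move=> x _; rewrite lee_fin ltW.
- exact/measurable_EFinP.
by rewrite lte_mul_pinfty// lee_fin sqr_ge0.
Qed.

(** The weight k_n = min(|e|, n kappa o phi) satisfies k_n <= |e|, hence
    2 int k_n |e| <= 2 int k_n |g| <= int k_n^2 + int g^2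
                  <= int k_n |e| + int g^2,
    and int k_n |e| is finite, so it is at most int g^2. As n grows, k_n |e|
    increases to e^2. *)
Lemma rcondexp_contraction g e : measurable_fun [set: X] g ->
  (\int[nu]_x (g x ^+ 2)%:E < +oo)%E -> is_rcondexp nu phi g e ->
  (\int[nu]_x (e x ^+ 2)%:E <= \int[nu]_x (g x ^+ 2)%:E)%E.
Proof.
move=> mg goo ge; have me := mX ge.1.
pose k n x : R := Num.min `|e x| (n%:R * kappa (phi x)).
have k0 n x : 0 <= k n x by rewrite le_min normr_ge0 mulr_ge0// ltW.
have mk' n : measurable_fun [set: Xphi] (k n : Xphi -> R).
  apply: measurable_minr; last exact: measurable_funM.
  by apply: measurableT_comp => //; exact: ge.1.
have mkX n := mX (mk' n).
have mke n : measurable_fun [set: X] (fun x => k n x * `|e x|).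
  by apply: measurable_funM => //; exact: measurableT_comp.
have mkg n : measurable_fun [set: X] (fun x => k n x * `|g x|).
  by apply: measurable_funM => //; exact: measurableT_comp.
have bound n : (\int[nu]_x (k n x * `|e x|)%:E <= \int[nu]_x (g x ^+ 2)%:E)%E.
  have kgoo : (\int[nu]_x (k n x * `|g x|)%:E < +oo)%E.
    apply: (weight_sqr_lty (c := n%:R)) => // x.
    by rewrite ge_min lexx orbT.
  have [kekg _ _] := rcondexp_weight mg goo ge (mk' n) (k0 n) kgoo.
  have J0 : (0 <= \int[nu]_x (k n x * `|e x|)%:E)%E.
    by apply: integral_ge0 => x _; rewrite lee_fin mulr_ge0.
  have Jfin : (\int[nu]_x (k n x * `|e x|)%:E)%E \is a fin_num.
    by rewrite ge0_fin_numE// (le_lt_trans kekg).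
  rewrite -(leeD2lE _ _ Jfin).
  apply: (le_trans (leeD kekg kekg)).
  rewrite -!ge0_integralD//; last 8 first.
  - by move=> x _; rewrite lee_fin mulr_ge0.
  - exact/measurable_EFinP.
  - by move=> x _; rewrite lee_fin sqr_ge0.
  - by apply/measurable_EFinP; exact: measurable_funX.
  - by move=> x _; rewrite lee_fin mulr_ge0.
  - exact/measurable_EFinP.
  - by move=> x _; rewrite lee_fin mulr_ge0.
  - exact/measurable_EFinP.
  under eq_integral do rewrite -EFinD.
  under [leRHS]eq_integral do rewrite -EFinD.
  apply: ge0_integral_ler.
  - exact: measurable_funD.
  - by apply: measurable_funD => //; exact: measurable_funX.
  - by move=> x; rewrite addr_ge0// mulr_ge0.
  - move=> x; have := sqr_ge0 (k n x - `|g x|).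
    rewrite sqrrB real_normK ?num_real// -mulr_natl.
    have : k n x * k n x <= k n x * `|e x|.
      by rewrite ler_wpM2l// ge_min lexx.
    rewrite -expr2; lra.
have -> : (\int[nu]_x (e x ^+ 2)%:E =
           limn (fun n => \int[nu]_x (k n x * `|e x|)%:E))%E.
  rewrite -monotone_convergence//; last 3 first.
  - by move=> n; exact/measurable_EFinP.
  - by move=> n x _; rewrite lee_fin mulr_ge0.
  - move=> x _ i j ij; rewrite lee_fin ler_wpM2r// le_min ge_min lexx/=.
    by rewrite ge_min ler_wpM2r ?orbT ?ler_nat// ltW.
  apply: eq_integral => x _; apply/esym/cvg_lim => //.
  apply: cvg_near_cst; near=> n; congr (_%:E).
  rewrite /k; have -> : Num.min `|e x| (n%:R * kappa (phi x)) = `|e x|.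
    apply/min_idPl; rewrite -ler_pdivrMr//.
    by near: n; exact: nbhs_infty_ger.
  by rewrite -expr2 real_normK ?num_real.
apply: lime_le; last exact: nearW.
apply: ereal_nondecreasing_is_cvgn => i j ij.
apply: ge0_integral_ler => // x; first by rewrite mulr_ge0.
rewrite ler_wpM2r// le_min ge_min lexx/=.
by rewrite ge_min ler_wpM2r ?orbT ?ler_nat// ltW.
Unshelve. all: by end_near. Qed.

(** Weighting by kappa makes g integrable, so that the image under phi of
    (kappa o phi) g nu is a finite measure. Its density G with respect to the image
    of nu gives the conditional expectation (G / kappa) o phi. *)
Let ge0_rcondexp_exists g : measurable_fun [set: X] g -> (forall x, 0 <= g x) ->
  (\int[nu]_x (g x ^+ 2)%:E < +oo)%E -> exists e, is_rcondexp nu phi g e.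
Proof.
move=> mg g0 goo.
pose f x := (kappa (phi x) * g x)%:E.
have mf : measurable_fun [set: X] f.
  by apply/measurable_EFinP; exact: measurable_funM.
have f0 x : (0 <= f x)%E by rewrite lee_fin mulr_ge0// ltW.
have m1 : measurable_fun [set: X] (cst (1%:E : \bar R)) by [].
have [m mE] := image_density_measure nu mphi mf f0.
have [la laE] := image_density_measure nu mphi m1 (fun _ => lee01).
have laE' A : measurable A -> la A = nu (phi @^-1` A).
  by move=> mA; rewrite laE integral_cst ?mul1e//; exact: mpre.
have la_int (k : X -> R) : measurable_fun [set: X] k -> (forall x, 0 <= k x) ->
    (\int[la]_x (k x)%:E = \int[nu]_x (k (phi x))%:E)%E.
  move=> mk' k0; rewrite (integral_image_density (m := nu) mphi (f := cst 1))//.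
  by under eq_integral do rewrite mulr1.
have sla : sigma_finite setT la.
  apply: (sigma_finite_weight mkappa) => //; rewrite la_int// => x.
  exact: ltW.
have moo : (m setT < +oo)%E.
  rewrite mE preimage_setT.
  have kle x : (kappa \o phi) x <= 1 * kappa (phi x) by rewrite mul1r.
  have := weight_sqr_lty mg mk ler01 (fun x => ltW (kappa0 (phi x))) kle goo.
  by under eq_integral do rewrite ger0_norm//.
have mla : m `<< la.
  apply/null_content_dominatesP => A mA laA0.
  have nuA0 : nu (phi @^-1` A) = 0%E by rewrite -(laE' _ mA); exact: laA0.
  rewrite mE; apply: null_set_integral => //; first exact: mpre.
  exact: measurable_funTS.
have [G [mG G0 GE]] := radon_nikodym_real sla moo mla.
pose e x := G (phi x) / kappa (phi x).
have e0 x : 0 <= e x by rewrite divr_ge0// ltW.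
have mGk : measurable_fun [set: X] (fun x => G x / kappa x).
  by apply: measurable_funM => //; exact: measurable_funV.
have me : measurable_fun [set: Xphi] (e : Xphi -> R).
  exact: (measurable_fun_preimage (f := fun x => G x / kappa x)).
have meX := mX me.
have ee A : measurable A -> (\int[nu]_(x in phi @^-1` A) (e x)%:E =
    \int[nu]_(x in phi @^-1` A) (g x)%:E)%E.
  move=> mA; rewrite -(integral_indicM _ _ e) -(integral_indicM _ _ g).
  have := @integral_preimage_weight
    (EFin \o (G \o phi)) f (fun x => (\1_(phi @^-1` A) x / kappa (phi x))%:E).
  have E1 : (\int[nu]_x ((\1_(phi @^-1` A) x / kappa (phi x))%:E *
      (EFin \o (G \o phi)) x) = \int[nu]_x (\1_(phi @^-1` A) x * e x)%:E)%E.
    apply: eq_integral => x _; rewrite /= -EFinM; congr (_%:E).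
    by rewrite /e; ring.
  have E2 : (\int[nu]_x ((\1_(phi @^-1` A) x / kappa (phi x))%:E * f x) =
      \int[nu]_x (\1_(phi @^-1` A) x * g x)%:E)%E.
    apply: eq_integral => x _; rewrite /f -EFinM; congr (_%:E).
    by have := kappa0 (phi x) => ?; field; rewrite gt_eqF.
  rewrite E1 E2; apply.
  - by apply/measurable_EFinP; exact: measurableT_comp.
  - exact: mf.
  - by move=> x; rewrite lee_fin; exact: G0.
  - exact: f0.
  - move=> B mB; rewrite -mE GE// -(integral_indicM _ _ G) la_int.
    + by rewrite -(integral_indicM _ _ (G \o phi)).
    + apply: measurable_funM => //; exact: measurable_indic.
    + by move=> x; rewrite mulr_ge0.
  - apply/measurable_EFinP; apply: measurable_funM.
      by apply: measurable_indic; exact: preimage_measurable.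
    exact: measurable_funV.
  - by move=> x; rewrite lee_fin mulr_ge0// invr_ge0 ltW.
exists e; split => // A mA Aoo; split; last exact: ee.
apply/integrableP; split.
  by apply/measurable_EFinP; exact: measurable_funTS.
under eq_integral do rewrite /= ger0_norm//.
rewrite ee//; apply: integrable_lty; first exact: mpre.
by apply: integrable_sqr_finite_set => //; exact: mpre.
Qed.

Lemma rcondexp_exists g : measurable_fun [set: X] g ->
  (\int[nu]_x (g x ^+ 2)%:E < +oo)%E -> exists e, is_rcondexp nu phi g e.
Proof.
move=> mg goo.
have mp : measurable_fun [set: X] (fun x => Num.max (g x) 0).
  exact: measurable_maxr.
have mn : measurable_fun [set: X] (fun x => Num.max (- g x) 0).
  by apply: measurable_maxr => //; exact: measurableT_comp.
have poo : (\int[nu]_x (Num.max (g x) 0 ^+ 2)%:E < +oo)%E.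
  apply: le_lt_trans goo; apply: ge0_integral_ler => //.
  - exact: measurable_funX.
  - exact: measurable_funX.
  - by move=> x; exact: sqr_ge0.
  - move=> x; rewrite /Num.max; case: ifP => // _.
    by rewrite expr0n sqr_ge0.
have noo : (\int[nu]_x (Num.max (- g x) 0 ^+ 2)%:E < +oo)%E.
  apply: le_lt_trans goo; apply: ge0_integral_ler => //.
  - exact: measurable_funX.
  - exact: measurable_funX.
  - by move=> x; exact: sqr_ge0.
  - move=> x; rewrite /Num.max; case: ifP => // _.
      by rewrite expr0n sqr_ge0.
    by rewrite sqrrN.
have [|e1 [me1 ge1]] := ge0_rcondexp_exists mp _ poo.
  by move=> x; rewrite le_max lexx orbT.
have [|e2 [me2 ge2]] := ge0_rcondexp_exists mn _ noo.
  by move=> x; rewrite le_max lexx orbT.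
exists (fun x => e1 x - e2 x); split; first exact: measurable_funB.
move=> A mA Aoo; have [i1 E1] := ge1 A mA Aoo; have [i2 E2] := ge2 A mA Aoo.
have mA' := mpre mA.
split.
  have -> : EFin \o (fun x => e1 x - e2 x) =
    (fun x => (e1 x)%:E - (e2 x)%:E)%E by [].
  exact: integrableB.
rewrite integralB_EFin// E1 E2 -integralB_EFin//; last 2 first.
- exact: integrable_sqr_finite_set.
- exact: integrable_sqr_finite_set.
apply: eq_integral => x _; congr (_%:E).
rewrite /Num.max; case: ifPn; case: ifPn; lra.
Qed.

(** The sets {D >= 0} and {D < 0} belong to phi^-1(A), so |D| has integral 0. *)
Lemma preimage_ae_eq0 (D : X -> R) : measurable_fun [set: Xphi] (D : Xphi -> R) ->
  nu.-integrable [set: X] (EFin \o D) ->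
  (forall A, measurable A -> \int[nu]_(x in phi @^-1` A) (D x)%:E = 0)%E ->
  \forall x \ae nu, D x = 0.
Proof.
move=> mD iD D0; have mDX := mX mD.
suff : ae_eq nu setT (EFin \o D) (cst 0%E).
  by apply: filterS => x /(_ I) [].
apply/ae_eq_integral_abs => //; first exact/measurable_EFinP.
pose B : set X := [set x | 0 <= D x].
have mB : measurable (B : set Xphi).
  have := measurable_fun_ler (@measurable_cst _ _ Xphi _ setT (0 : R)) mD.
  by move=> /(_ measurableT [set true]); rewrite setTI; apply.
have [A mA AB] := measurable_preimageT mB.
have mBX : measurable B by exact: (measurable_coarser mphi mB).
have mCX : measurable (~` B) by exact: measurableC.
rewrite -(setUv B) ge0_integral_setU//; last 2 first.
- by rewrite setUv; apply/measurable_EFinP; exact: measurableT_comp.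
- by apply/disj_set2P; rewrite setICr.
rewrite (eq_integral (EFin \o D)); last first.
  by move=> x; rewrite inE => xB; rewrite /= ger0_norm.
rewrite AB D0// add0e -AB.
rewrite (eq_integral (fun x => - (D x)%:E)%E); last first.
  move=> x; rewrite inE => xB; rewrite /= ler0_norm ?EFinN//.
  by rewrite leNgt; apply/negP => /ltW.
rewrite integralN/=; last first.
  by apply: integrable_add_def => //; exact: (@integrableS _ _ _ nu setT).
by rewrite AB preimage_setC D0 ?oppe0//; exact: measurableC.
Qed.

(** Dividing by 1 + a keeps both the weight and its product with a below
    kappa o phi. *)
Let damp a x := kappa (phi x) / (1 + a x).

Let damp_gt0 a : (forall x, 0 <= a x) -> forall x, 0 < damp a x.
Proof. by move=> a0 x; rewrite divr_gt0// ltr_pwDl. Qed.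

Let damp_le a : (forall x, 0 <= a x) -> forall x, damp a x <= kappa (phi x).
Proof.
move=> a0 x; rewrite ler_pdivrMr ?ltr_pwDl// ler_peMr ?lerDl//.
exact: ltW.
Qed.

Let damp_mul_le a : (forall x, 0 <= a x) ->
  forall x, damp a x * a x <= kappa (phi x).
Proof.
move=> a0 x; rewrite /damp mulrAC ler_pdivrMr ?ltr_pwDl// ler_wpM2l ?lerDr//.
exact: ltW.
Qed.

Let damp_measurable a : measurable_fun [set: Xphi] (a : Xphi -> R) ->
  measurable_fun [set: Xphi] (damp a : Xphi -> R).
Proof.
move=> ma; apply: measurable_funM => //.
by apply: measurable_funV; exact: measurable_funD.
Qed.

Let indic0 (A : set X) x : 0 <= \1_A x :> R.
Proof. by rewrite indicE. Qed.

Let indic1 (A : set X) x : \1_A x <= 1 :> R.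
Proof. by rewrite indicE; case: (x \in A). Qed.

Let mindic (A : set X) : measurable A ->
  measurable_fun [set: Xphi] (\1_(phi @^-1` A) : Xphi -> R).
Proof. by move=> mA; apply: measurable_indic; exact: preimage_measurable. Qed.

(** Tested against the weight damp a, both sides of e2 = a * e1 have the same
    integral over each set of phi^-1(A). The weight makes a * e1 integrable even
    when a is unbounded. *)
Lemma rcondexp_mul g (h : X -> R) a e1 e2 :
  measurable_fun [set: X] g -> measurable_fun [set: X] h ->
  (\int[nu]_x (g x ^+ 2)%:E < +oo)%E ->
  (\int[nu]_x ((h x * g x) ^+ 2)%:E < +oo)%E ->
  measurable_fun [set: Xphi] (a : Xphi -> R) -> (forall x, 0 <= a x) ->
  (\forall x \ae nu, h x = a x) ->
  is_rcondexp nu phi g e1 -> is_rcondexp nu phi (fun x => h x * g x) e2 ->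
  \forall x \ae nu, e2 x = a x * e1 x.
Proof.
move=> mg mh goo hgoo ma a0 ha ge1 ge2.
have maX := mX ma; have md := damp_measurable ma; have mdX := mX md.
have d0 := damp_gt0 a0.
have mhg : measurable_fun [set: X] (fun x => h x * g x) by exact: measurable_funM.
pose D x := damp a x * e2 x - (damp a x * a x) * e1 x.
have da0 x : 0 <= damp a x * a x by rewrite mulr_ge0// ltW.
have mda : measurable_fun [set: Xphi] (fun x => damp a x * a x : R).
  exact: measurable_funM.
suff : \forall x \ae nu, D x = 0.
  apply: filterS => x /eqP.
  have -> : D x = damp a x * (e2 x - a x * e1 x) by rewrite /D; ring.
  by rewrite mulf_eq0 (gt_eqF (d0 x))/= subr_eq0 => /eqP.
have w2 A : measurable A ->
  nu.-integrable [set: X] (EFin \o (fun x => (\1_(phi @^-1` A) x * damp a x) * e2 x)) /\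
  (\int[nu]_x ((\1_(phi @^-1` A) x * damp a x) * e2 x)%:E =
   \int[nu]_x ((\1_(phi @^-1` A) x * damp a x) * (h x * g x))%:E)%E.
  move=> mA; have mi := mindic mA.
  have mid : measurable_fun [set: Xphi] (fun x => \1_(phi @^-1` A) x * damp a x : R).
    exact: measurable_funM.
  have id0 x : 0 <= \1_(phi @^-1` A) x * damp a x by rewrite mulr_ge0// ltW.
  have [] := rcondexp_weight mhg hgoo ge2 mid id0; last by [].
  apply: (weight_sqr_lty (c := 1)) => //; first exact: mX.
  move=> x; rewrite mul1r; apply: le_trans (damp_le a0 x).
  by rewrite ler_piMl// ltW.
have w1 A : measurable A ->
  nu.-integrable [set: X] (EFin \o (fun x => (\1_(phi @^-1` A) x * (damp a x * a x)) * e1 x)) /\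
  (\int[nu]_x ((\1_(phi @^-1` A) x * (damp a x * a x)) * e1 x)%:E =
   \int[nu]_x ((\1_(phi @^-1` A) x * (damp a x * a x)) * g x)%:E)%E.
  move=> mA; have mi := mindic mA.
  have mid : measurable_fun [set: Xphi] (fun x => \1_(phi @^-1` A) x * (damp a x * a x) : R).
    exact: measurable_funM.
  have id0 x : 0 <= \1_(phi @^-1` A) x * (damp a x * a x) by rewrite mulr_ge0.
  have [] := rcondexp_weight mg goo ge1 mid id0; last by [].
  apply: (weight_sqr_lty (c := 1)) => //; first exact: mX.
  move=> x; rewrite mul1r; apply: le_trans (damp_mul_le a0 x).
  by rewrite ler_piMl.
have intD A : measurable A ->
    nu.-integrable [set: X] (EFin \o (fun x => \1_(phi @^-1` A) x * D x)) /\
    (\int[nu]_x (\1_(phi @^-1` A) x * D x)%:E = 0)%E.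
  move=> mA; have [i1 E1] := w1 A mA; have [i2 E2] := w2 A mA.
  have DE : EFin \o (fun x => \1_(phi @^-1` A) x * D x) =
     (fun x => ((\1_(phi @^-1` A) x * damp a x) * e2 x)%:E -
      ((\1_(phi @^-1` A) x * (damp a x * a x)) * e1 x)%:E)%E.
    by apply/funext => x; rewrite -EFinB /=; congr (_%:E); rewrite /D; ring.
  split; first by rewrite DE; exact: integrableB.
  have -> : (\int[nu]_x (\1_(phi @^-1` A) x * D x)%:E =
    \int[nu]_x (((\1_(phi @^-1` A) x * damp a x) * e2 x) -
      ((\1_(phi @^-1` A) x * (damp a x * a x)) * e1 x))%:E)%E.
    by apply: eq_integral => x _; congr (_%:E); rewrite /D; ring.
  rewrite integralB_EFin// E1 E2.
  have -> : (\int[nu]_x ((\1_(phi @^-1` A) x * damp a x) * (h x * g x))%:E =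
     \int[nu]_x ((\1_(phi @^-1` A) x * (damp a x * a x)) * g x)%:E)%E.
    have miX := mX (mindic mA).
    apply: ae_eq_integral => //.
    - by apply/measurable_EFinP; apply: measurable_funM => //; exact: measurable_funM.
    - apply/measurable_EFinP; apply: measurable_funM => //.
      by apply: measurable_funM => //; exact: mX.
    - by apply: filterS ha => x -> _; congr (_%:E); ring.
  rewrite -E1 subee//; exact: integrable_fin_num i1.
apply: preimage_ae_eq0.
- by apply: measurable_funB; apply: measurable_funM => //; [exact: ge2.1|exact: ge1.1].
- have [+ _] := intD setT measurableT; rewrite preimage_setT.
  congr (nu.-integrable _ _); apply/funext => x /=.
  by rewrite indicE in_setT mul1r.
- by move=> A mA; rewrite -(integral_indicM _ _ D); exact: (intD A mA).2.
Qed.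

(** If g > 0 then E(g) is a.e. nonzero, and h E(g) = E(h g) can be solved
    for h. *)
Lemma rcondexp_ratio g (h : X -> R) e1 e2 :
  measurable_fun [set: X] g ->
  (forall x, 0 <= h x) ->
  (\forall x \ae nu, 0 < g x) ->
  (\int[nu]_x (g x ^+ 2)%:E < +oo)%E ->
  is_rcondexp nu phi g e1 -> measurable_fun [set: Xphi] (e2 : Xphi -> R) ->
  (\forall x \ae nu, h x * e1 x = e2 x) ->
  exists a : X -> R, [/\ measurable_fun [set: Xphi] (a : Xphi -> R),
    forall x, 0 <= a x & \forall x \ae nu, h x = a x].
Proof.
move=> mg h0 g0 goo ge1 me2 he; have me1 := ge1.1; have me1X := mX me1.
exists (fun x => `|e2 x / e1 x|); split => //.
  apply: measurableT_comp => //; apply: measurable_funM => //.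
  exact: measurable_funV.
(* It remains to see that e1 is a.e. nonzero: g has integral 0 over the zero set
   of e1, on which it is positive. *)
pose k x : R := if e1 x == 0 then kappa (phi x) else 0.
have mk' : measurable_fun [set: Xphi] (k : Xphi -> R).
  by apply: measurable_fun_ifT => //; exact: measurable_fun_eqr.
have k0 x : 0 <= k x by rewrite /k; case: ifP => // _; exact: ltW.
have kk x : k x <= 1 * kappa (phi x).
  by rewrite mul1r /k; case: ifP => // _; exact: ltW.
have mkX := mX mk'.
have kgoo := weight_sqr_lty mg mkX ler01 k0 kk goo.
have [_ _ E] := rcondexp_weight mg goo ge1 mk' k0 kgoo.
have Kg0 : (\int[nu]_x `|(k x * `|g x|)%:E| = 0)%E.
  under eq_integral do rewrite /= ger0_norm ?mulr_ge0//.
  have -> : (\int[nu]_x (k x * `|g x|)%:E = \int[nu]_x (k x * g x)%:E)%E.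
    apply: ae_eq_integral => //.
    - apply/measurable_EFinP; apply: measurable_funM => //.
      exact: measurableT_comp.
    - by apply/measurable_EFinP; exact: measurable_funM.
    - by apply: filterS g0 => x gx _; rewrite gtr0_norm.
  rewrite -E; apply: integral0_eq => x _; rewrite /k.
  by case: eqVneq => [->|_]; rewrite ?mulr0 ?mul0r.
have : ae_eq nu setT (fun x => (k x * `|g x|)%:E) (cst 0%E).
  apply/ae_eq_integral_abs => //; apply/measurable_EFinP.
  by apply: measurable_funM => //; exact: measurableT_comp.
apply: filterS3 g0 he => x gx hx /(_ I) kgx.
have : k x * `|g x| == 0 by apply/eqP; exact: (EFin_inj kgx).
rewrite mulf_eq0 normr_eq0 (gt_eqF gx) orbF /k.
case: (eqVneq (e1 x) 0) => [_|e10 _]; first by rewrite gt_eqF.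
by rewrite -hx mulfK// ger0_norm.
Qed.

(** A function a measurable for phi^-1(A) and a.e. equal to h is a conditional
    expectation of h. To compare it with the chosen one, c, which may take the value
    +oo, both are multiplied by damp a: then they are integrable. *)
Lemma condexp_fixP (h : X -> \bar R) :
  measurable_fun [set: X] h -> (forall x, 0 <= h x)%E ->
  (\forall x \ae nu, h x \is a fin_num) ->
  (\forall x \ae nu, condexp nu phi h x = h x) <->
  exists a : X -> R, [/\ measurable_fun [set: Xphi] (a : Xphi -> R),
    forall x, 0 <= a x & \forall x \ae nu, fine (h x) = a x].
Proof.
move=> mh h0 hfin; split=> [ch|[a [ma a0 ha]]].
  (* If h has no conditional expectation then the chosen value is 0, which is
     measurable as well. *)
  have [mc c0] : measurable_fun [set: Xphi] (condexp nu phi h : Xphi -> \bar R) /\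
      forall x, (0 <= condexp nu phi h x)%E.
    by rewrite /condexp; case: xgetP => [e _ [? ? _]|_].
  exists (fine \o condexp nu phi h); split.
  - exact: (measurableT_comp (f := @fine R)).
  - by move=> x; exact: fine_ge0.
  - by apply: filterS ch => x /= ->.
have maX := mX ma.
have ah : \forall x \ae nu, h x = (a x)%:E.
  by apply: filterS2 hfin ha => x hx <-; rewrite fineK.
have Ea A : measurable A -> (\int[nu]_(x in phi @^-1` A) (a x)%:E =
    \int[nu]_(x in phi @^-1` A) h x)%E.
  move=> mA; apply: ae_eq_integral; first exact: mpre.
  - by apply: measurable_funTS; exact/measurable_EFinP.
  - exact: measurable_funTS.
  - by apply: filterS ah => x -> _.
have [mc c0 cE] : is_condexp nu phi h (condexp nu phi h).
  apply: (@xgetPex _ _ (is_condexp nu phi h)); exists (EFin \o a); split => //.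
  exact/measurable_EFinP.
move: (condexp _ _ _) mc c0 cE => c mc c0 cE.
have mcX : measurable_fun [set: X] c by exact: (measurable_fun_coarser mphi mc).
have md := damp_measurable ma; have mdX := mX md; have d0 := damp_gt0 a0.
have W A : measurable A ->
    (\int[nu]_x ((\1_(phi @^-1` A) x * damp a x)%:E * c x) =
     \int[nu]_x (\1_(phi @^-1` A) x * (damp a x * a x))%:E)%E.
  move=> mA; have -> : (\int[nu]_x (\1_(phi @^-1` A) x * (damp a x * a x))%:E =
      \int[nu]_x ((\1_(phi @^-1` A) x * damp a x)%:E * (EFin \o a) x))%E.
    by apply: eq_integral => x _; rewrite -EFinM mulrA.
  apply: integral_preimage_weight => //.
  - exact/measurable_EFinP.
  - by move=> B mB; rewrite cE// -Ea.
  - by apply/measurable_EFinP; apply: measurable_funM => //; exact: mindic.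
  - by move=> x; rewrite lee_fin mulr_ge0// ltW.
have mdc : measurable_fun [set: X] (fun x => (damp a x)%:E * c x)%E.
  by apply: emeasurable_funM => //; exact/measurable_EFinP.
have dc0 x : (0 <= (damp a x)%:E * c x)%E.
  by rewrite mule_ge0// lee_fin ltW.
have mda : measurable_fun [set: X] (fun x => damp a x * a x) by exact: measurable_funM.
have da0 x : 0 <= damp a x * a x by rewrite mulr_ge0// ltW.
have ida : nu.-integrable [set: X] (EFin \o (fun x => damp a x * a x)).
  apply: (@integrable_le _ _ _ _ _ _ (kappa \o phi)) => //.
    by move=> x; rewrite ger0_norm//; exact: (damp_mul_le a0 x).
  by apply: ge0_integrable => // x; exact/ltW/kappa0.
have idc : nu.-integrable [set: X] (fun x => (damp a x)%:E * c x)%E.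
  apply/integrableP; split => //.
  under eq_integral do rewrite gee0_abs//.
  have := W setT measurableT; rewrite preimage_setT.
  under eq_integral do rewrite indicT mul1r.
  move=> ->; under eq_integral do rewrite indicT mul1r.
  by apply: integrable_lty.
have cfin : \forall x \ae nu, c x \is a fin_num.
  have := integrable_ae measurableT idc; apply: filterS => x /(_ I).
  have := c0 x; case: (c x) => [//| |//] _.
  by rewrite gt0_muley ?lte_fin.
pose D x := damp a x * fine (c x) - damp a x * a x.
suff : \forall x \ae nu, D x = 0.
  apply: filterS3 cfin ah => x cx hx /eqP.
  by rewrite /D -mulrBr mulf_eq0 (gt_eqF (d0 x))/= subr_eq0 => /eqP cax;
    rewrite hx -cax fineK.
have idf : nu.-integrable [set: X] (EFin \o (fun x => damp a x * fine (c x))).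
  apply: le_integrable idc => //.
    apply/measurable_EFinP; apply: measurable_funM => //.
    exact: measurableT_comp.
  move=> x _; rewrite [leRHS]gee0_abs//= normrM (ger0_norm (ltW (d0 x))) EFinM.
  apply: lee_wpmul2l; first by rewrite lee_fin ltW.
  by have := c0 x; case: (c x) => [r| |]//= r0; rewrite ?ger0_norm ?normr0 ?leey.
apply: preimage_ae_eq0.
- by apply: measurable_funB; apply: measurable_funM => //; exact: measurableT_comp.
- have -> : EFin \o D =
    (fun x => (damp a x * fine (c x))%:E - (damp a x * a x)%:E)%E by [].
  exact: integrableB.
- move=> A mA; have mA' := mpre mA.
  have idfA : nu.-integrable (phi @^-1` A) (EFin \o (fun x => damp a x * fine (c x))).
    exact: (@integrableS _ _ _ nu setT).
  have idaA : nu.-integrable (phi @^-1` A) (EFin \o (fun x => damp a x * a x)).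
    exact: (@integrableS _ _ _ nu setT).
  rewrite integralB_EFin//.
  have -> : (\int[nu]_(x in phi @^-1` A) (damp a x * fine (c x))%:E =
             \int[nu]_(x in phi @^-1` A) (damp a x * a x)%:E)%E.
    rewrite -(integral_indicM _ _ (fun x => damp a x * fine (c x))).
    rewrite -(integral_indicM _ _ (fun x => damp a x * a x)) -W//.
    have miX := mX (mindic mA).
    apply: ae_eq_integral => //.
    - apply/measurable_EFinP; apply: measurable_funM => //.
      by apply: measurable_funM => //; exact: measurableT_comp.
    - apply: emeasurable_funM => //; apply/measurable_EFinP.
      exact: measurable_funM.
    - by apply: filterS cfin => x cx _; rewrite mulrA EFinM fineK.
  by rewrite subee//; exact: integrable_fin_num idaA.
Qed.

End preimage_condexp.

(** * Complex-valued functions and L^2 *)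

Section complex_measurability.
Context d (X : measurableType d) (R : realType).
Implicit Types f g : X -> R[i].

Lemma complex_ReM (z t : R[i]) :
  complex.Re (z * t) = complex.Re z * complex.Re t - complex.Im z * complex.Im t.
Proof. by case: z t => [a b] [c e]. Qed.

Lemma complex_ImM (z t : R[i]) :
  complex.Im (z * t) = complex.Re z * complex.Im t + complex.Im z * complex.Re t.
Proof. by case: z t => [a b] [c e]. Qed.

Lemma complex_ReMl (r : R) (z : R[i]) : complex.Re (r%:C%C * z) = r * complex.Re z.
Proof. by case: z => a b /=; rewrite mul0r subr0. Qed.

Lemma complex_ImMl (r : R) (z : R[i]) : complex.Im (r%:C%C * z) = r * complex.Im z.
Proof. by case: z => a b /=; rewrite mul0r addr0. Qed.

Lemma normc2M (z t : R[i]) :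
  Normc.normc (z * t) ^+ 2 = Normc.normc z ^+ 2 * Normc.normc t ^+ 2.
Proof. by rewrite Normc.normcM exprMn. Qed.

Lemma normc2_gt0 (z : R[i]) : z != 0 -> 0 < Normc.normc z ^+ 2.
Proof.
move=> z0; rewrite exprn_even_gt0//=; apply: contra z0 => /eqP z0.
by apply/eqP; exact: Normc.eq0_normc.
Qed.

Lemma cmeasurable_normc2 f : cmeasurable f ->
  measurable_fun [set: X] (fun x => Normc.normc (f x) ^+ 2).
Proof.
move=> [mr mi]; under eq_fun do rewrite Defs.normcE.
by apply: measurable_funD; exact: measurable_funX.
Qed.

Lemma cmeasurableM f g : cmeasurable f -> cmeasurable g ->
  cmeasurable (fun x => f x * g x).
Proof.
move=> [fr fi] [gr gi]; split.
  under eq_fun do rewrite complex_ReM.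
  by apply: measurable_funB; exact: measurable_funM.
under eq_fun do rewrite complex_ImM.
by apply: measurable_funD; exact: measurable_funM.
Qed.

Lemma cmeasurableB f g : cmeasurable f -> cmeasurable g ->
  cmeasurable (fun x => f x - g x).
Proof.
move=> [fr fi] [gr gi]; split.
  have -> : (fun x => complex.Re (f x - g x)) =
      (fun x => complex.Re (f x) - complex.Re (g x)).
    by apply/funext => x; case: (f x) (g x) => [? ?] [? ?].
  exact: measurable_funB.
have -> : (fun x => complex.Im (f x - g x)) =
    (fun x => complex.Im (f x) - complex.Im (g x)).
  by apply/funext => x; case: (f x) (g x) => [? ?] [? ?].
exact: measurable_funB.
Qed.

Lemma cmeasurable_real (r : X -> R) : measurable_fun [set: X] r ->
  cmeasurable (fun x => (r x)%:C%C).
Proof. by move=> mr; split => //=; exact: measurable_cst. Qed.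

Lemma cmeasurable_comp d' (Y : measurableType d') (p : Y -> X) f :
  measurable_fun [set: Y] p -> cmeasurable f -> cmeasurable (f \o p).
Proof.
move=> mp [mr mi]; split.
  exact: (measurableT_comp (f := fun x => complex.Re (f x))).
exact: (measurableT_comp (f := fun x => complex.Im (f x))).
Qed.

Lemma cmeasurable_wquot w f : cmeasurable w -> cmeasurable f ->
  cmeasurable (wquot w f).
Proof.
move=> mw mf.
have mwi : cmeasurable (fun x => (w x)^-1).
  have mn := cmeasurable_normc2 mw; have [wr wi] := mw; split.
    have -> : (fun x => complex.Re (w x)^-1) =
        (fun x => complex.Re (w x) * (Normc.normc (w x) ^+ 2)^-1).
      by apply/funext => x; rewrite Defs.normcE; case: (w x).
    by apply: measurable_funM => //; exact: measurable_funV.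
  have -> : (fun x => complex.Im (w x)^-1) =
      (fun x => - (complex.Im (w x) * (Normc.normc (w x) ^+ 2)^-1)).
    by apply/funext => x; rewrite Defs.normcE; case: (w x).
  apply: measurableT_comp => //.
  by apply: measurable_funM => //; exact: measurable_funV.
have -> : wquot w f = (fun x => f x * (w x)^-1).
  apply/funext => x; rewrite /wquot; case: eqVneq => //= ->.
  by rewrite invr0 mulr0.
exact: cmeasurableM.
Qed.

End complex_measurability.

Section L2_lemmas.
Context d (X : measurableType d) (R : realType) (mu : {measure set X -> \bar R}).
Implicit Types f g : X -> R[i].

Lemma L2norm_sqr f :
  (L2norm mu f `^ 2 = \int[mu]_x (Normc.normc (f x) ^+ 2)%:E)%E.
Proof.
rewrite /L2norm poweR_Lnorm ?pnatr_eq0//; apply: eq_integral => x _.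
by rewrite /= powR_mulrn ?normr_ge0// real_normK ?num_real.
Qed.

Lemma L2P f : L2 mu f <->
  cmeasurable f /\ (\int[mu]_x (Normc.normc (f x) ^+ 2)%:E < +oo)%E.
Proof.
rewrite -L2norm_sqr; split=> -[mf foo]; split => //; first exact: poweR_lty.
rewrite ltNge leye_eq; apply/eqP => E; move: foo; rewrite E poweRyr//.
Qed.

Lemma L2_ae_eq f g : cmeasurable f -> L2 mu g ->
  (\forall x \ae mu, g x = f x) -> L2 mu f.
Proof.
move=> mf /L2P[mg goo] gf; apply/L2P; split => //.
rewrite (_ : integral _ _ _ =
  (\int[mu]_x (Normc.normc (g x) ^+ 2)%:E)%E)//.
apply: ae_eq_integral => //.
- by apply/measurable_EFinP; exact: cmeasurable_normc2.
- by apply/measurable_EFinP; exact: cmeasurable_normc2.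
- by apply: filterS gf => x -> _.
Qed.

End L2_lemmas.

Section weighted_measure.
Context d (X : measurableType d) (R : realType) (mu : {measure set X -> \bar R}).
Variables (w : X -> R[i]) (mw : cmeasurable w).
Local Notation nu := (wmeasure mu mw).

Lemma integral_wmeasure (k : X -> R) :
  measurable_fun [set: X] k -> (forall x, 0 <= k x) ->
  (\int[nu]_x (k x)%:E = \int[mu]_x (k x * Normc.normc (w x) ^+ 2)%:E)%E.
Proof.
move=> mk k0; apply: (integral_image_density (m := mu) (M := nu)
  (@measurable_id _ X setT)) => //.
- exact: cmeasurable_normc2.
- by move=> x; exact: sqr_ge0.
Qed.

Lemma ae_wmeasureP (Q : X -> Prop) :
  (\forall x \ae nu, Q x) <-> (\forall x \ae mu, w x != 0 -> Q x).
Proof.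
have mw2 := cmeasurable_normc2 mw.
split=> [[N [mN N0 QN]]|[N [mN N0 QN]]].
- have : ae_eq mu N (fun x => (Normc.normc (w x) ^+ 2)%:E) (cst 0%E).
    apply/ae_eq_integral_abs => //.
      by apply: measurable_funTS; exact/measurable_EFinP.
    rewrite -[RHS]N0; apply: eq_integral => x _.
    by rewrite gee0_abs// lee_fin sqr_ge0.
  apply: filterS => x Nx w0; apply: contrapT => nQ.
  have /eqP : Normc.normc (w x) ^+ 2 = 0 := EFin_inj (Nx (QN _ nQ)).
  by rewrite gt_eqF// normc2_gt0.
- pose Z := [set x | Normc.normc (w x) ^+ 2 == 0].
  have mZ : measurable Z.
    have := measurable_fun_eqr mw2 (@measurable_cst _ _ X _ setT (0 : R)).
    by move=> /(_ measurableT [set true]); rewrite setTI; apply.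
  exists (N `|` Z); split; first exact: measurableU.
  + apply/eqP; rewrite -measure_le0.
    have muN : nu N = 0%E.
      apply: null_set_integral => //.
      by apply: measurable_funTS; exact/measurable_EFinP.
    have muZ : nu Z = 0%E by apply: integral0_eq => x /eqP ->.
    apply: (le_trans (measureU2 _ _ _)) => //; rewrite -[leRHS](adde0 0%E).
    by apply: leeD; [rewrite -muN|rewrite -muZ].
  + move=> x /= nQ; have [w0|w0] := eqVneq (w x) 0.
      by right; rewrite /Z /= w0 Normc.normc0 expr0n.
    by left; apply: QN => /= /(_ w0).
Qed.

End weighted_measure.

(** * The projection and multiplication operators *)

Section projection_commutation.
Context d (X : measurableType d) (R : realType) (mu : {measure set X -> \bar R}).
Variables (phi : X -> X) (w : X -> R[i]) (mw : cmeasurable w) (kappa : X -> R).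
Local Notation nu := (wmeasure mu mw).
Hypothesis mphi : measurable_fun [set: X] phi.
Hypothesis mkappa : measurable_fun [set: X] kappa.
Hypothesis kappa0 : forall x, 0 < kappa x.
Hypothesis kappa1 : forall x, kappa x <= 1.
Hypothesis ikappa : (\int[nu]_x (kappa (phi x))%:E < +oo)%E.
Local Notation P := (proj_op mu phi mw).
Local Notation E f := (ccondexp nu phi (wquot w f)).

Lemma wquot_norm_lty f : L2 mu f ->
  (\int[nu]_x (Normc.normc (wquot w f x) ^+ 2)%:E < +oo)%E.
Proof.
move=> /L2P[mf foo]; have mq := cmeasurable_wquot mw mf.
have mq2 := cmeasurable_normc2 mq; have mw2 := cmeasurable_normc2 mw.
rewrite integral_wmeasure//; last by move=> x; exact: sqr_ge0.
apply: le_lt_trans foo; apply: ge0_integral_ler.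
- exact: measurable_funM.
- exact: cmeasurable_normc2.
- by move=> x; rewrite mulr_ge0 ?sqr_ge0.
- move=> x; rewrite -normc2M /wquot; case: eqVneq => /= w0.
    by rewrite mul0r Normc.normc0 expr0n sqr_ge0.
  by rewrite divfK.
Qed.

Lemma Re_sqr_lty (q : X -> R[i]) : cmeasurable q ->
  (\int[nu]_x (Normc.normc (q x) ^+ 2)%:E < +oo)%E ->
  (\int[nu]_x (complex.Re (q x) ^+ 2)%:E < +oo)%E.
Proof.
move=> mq; apply: le_lt_trans; have [mr mi] := mq.
apply: ge0_integral_ler.
- exact: measurable_funX.
- exact: cmeasurable_normc2.
- by move=> x; exact: sqr_ge0.
- by move=> x; rewrite Defs.normcE lerDl sqr_ge0.
Qed.

Lemma Im_sqr_lty (q : X -> R[i]) : cmeasurable q ->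
  (\int[nu]_x (Normc.normc (q x) ^+ 2)%:E < +oo)%E ->
  (\int[nu]_x (complex.Im (q x) ^+ 2)%:E < +oo)%E.
Proof.
move=> mq; apply: le_lt_trans; have [mr mi] := mq.
apply: ge0_integral_ler.
- exact: measurable_funX.
- exact: cmeasurable_normc2.
- by move=> x; exact: sqr_ge0.
- by move=> x; rewrite Defs.normcE lerDr sqr_ge0.
Qed.

Lemma ccondexpP f : L2 mu f -> is_ccondexp nu phi (wquot w f) (E f).
Proof.
move=> fL2; have mq := cmeasurable_wquot mw fL2.1.
have qoo := wquot_norm_lty fL2.
have [e1 e1P] := rcondexp_exists mphi mkappa kappa0 kappa1 ikappa mq.1
  (Re_sqr_lty mq qoo).
have [e2 e2P] := rcondexp_exists mphi mkappa kappa0 kappa1 ikappa mq.2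
  (Im_sqr_lty mq qoo).
apply: (@xgetPex _ _ [set e | is_ccondexp nu phi (wquot w f) e]).
by exists (fun x => complex.Complex (e1 x) (e2 x)).
Qed.

Lemma cmeasurable_ccondexp f : L2 mu f -> cmeasurable (E f).
Proof.
move=> fL2; have [[m1 _] [m2 _]] := ccondexpP fL2.
by split; exact: (measurable_fun_coarser mphi).
Qed.

Lemma proj_L2 f : L2 mu f -> L2 mu (app P f).
Proof.
move=> fL2; have mq := cmeasurable_wquot mw fL2.1.
have qoo := wquot_norm_lty fL2; have [eR eI] := ccondexpP fL2.
have mE := cmeasurable_ccondexp fL2; have mE2 := cmeasurable_normc2 mE.
apply/L2P; split; first exact: cmeasurableM.
have -> : (\int[mu]_x (Normc.normc (app P f x) ^+ 2)%:E =
    \int[nu]_x (Normc.normc (E f x) ^+ 2)%:E)%E.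
  rewrite integral_wmeasure//; last by move=> x; exact: sqr_ge0.
  by apply: eq_integral => x _; rewrite /= normc2M mulrC.
under eq_integral do rewrite Defs.normcE EFinD.
rewrite ge0_integralD//; last 4 first.
- by move=> x _; rewrite lee_fin sqr_ge0.
- by apply/measurable_EFinP; apply: measurable_funX; exact: mE.1.
- by move=> x _; rewrite lee_fin sqr_ge0.
- by apply/measurable_EFinP; apply: measurable_funX; exact: mE.2.
have Roo := Re_sqr_lty mq qoo; have Ioo := Im_sqr_lty mq qoo.
rewrite lte_add_pinfty//.
- apply: (le_lt_trans _ Roo).
  exact: (rcondexp_contraction mphi mkappa kappa0 kappa1 ikappa mq.1 Roo eR).
- apply: (le_lt_trans _ Ioo).
  exact: (rcondexp_contraction mphi mkappa kappa0 kappa1 ikappa mq.2 Ioo eI).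
Qed.

(** Both sides say that h is a.e. measurable for phi^-1(A): through
    [rcondexp_ratio] and [rcondexp_mul] for the commutation, through [condexp_fixP]
    for the conditional expectation. *)
Lemma proj_commutes_iff (h : X -> \bar R) :
  measurable_fun [set: X] h -> (forall x, 0 <= h x)%E ->
  (\forall x \ae nu, h x \is a fin_num) ->
  op_le mu (op_comp P (mult_op mu h)) (op_comp (mult_op mu h) P) <->
  (\forall x \ae nu, condexp nu phi h x = h x).
Proof.
move=> mh h0 hfin.
rewrite (condexp_fixP mphi mkappa kappa0 ikappa mh h0 hfin).
pose hR x := fine (h x).
have mhR : measurable_fun [set: X] hR by exact: measurableT_comp.
have hR0 x : 0 <= hR x by exact: fine_ge0.
have mhRC : cmeasurable (fun x => (hR x)%:C%C) by exact: cmeasurable_real.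
have quotM f : wquot w (app (mult_op mu h) f) =
    (fun x => (hR x)%:C%C * wquot w f x).
  apply/funext => x; rewrite /wquot /=; case: ifP => _; last by rewrite mulr0.
  by rewrite mulrA.
split=> [PM|[a [ma a0 ha]]].
(* Commutation is tested on f = w g, where g > 0 is chosen such that g and h g
   are at most kappa o phi, hence square integrable. *)
- pose g x := kappa (phi x) / (1 + hR x).
  have mg : measurable_fun [set: X] g.
    apply: measurable_funM; first exact: measurableT_comp.
    by apply: measurable_funV; exact: measurable_funD.
  have g0 x : 0 < g x by rewrite divr_gt0// ltr_pwDl.
  have gk x : g x <= kappa (phi x).
    rewrite ler_pdivrMr ?ltr_pwDl// ler_peMr ?lerDl//; exact: ltW.
  have hgk x : hR x * g x <= kappa (phi x).
    rewrite /g mulrA ler_pdivrMr ?ltr_pwDl// mulrC ler_wpM2l ?lerDr//; exact: ltW.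
  have sqr_le (u : X -> R) : measurable_fun [set: X] u -> (forall x, 0 <= u x) ->
      (forall x, u x <= kappa (phi x)) -> (\int[nu]_x (u x ^+ 2)%:E < +oo)%E.
    move=> mu' u0 uk; apply: le_lt_trans ikappa; apply: ge0_integral_ler.
    - exact: measurable_funX.
    - exact: measurableT_comp.
    - by move=> x; exact: sqr_ge0.
    - move=> x; apply: le_trans (uk x); rewrite expr2 ler_piMl//.
      exact: le_trans (uk x) (kappa1 _).
  have wL2 (u : X -> R) : measurable_fun [set: X] u ->
      (\int[nu]_x (u x ^+ 2)%:E < +oo)%E -> L2 mu (fun x => w x * (u x)%:C%C).
    move=> mu' uoo; apply/L2P; split.
      by apply: cmeasurableM => //; exact: cmeasurable_real.
    move: uoo; rewrite integral_wmeasure//; last 2 first.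
    - exact: measurable_funX.
    - by move=> x; exact: sqr_ge0.
    congr (_ < _)%E; apply: eq_integral => x _; congr (_%:E).
    by rewrite normc2M [X in _ = _ * X]Defs.normcE /= expr0n addr0 mulrC.
  have goo : (\int[nu]_x (g x ^+ 2)%:E < +oo)%E by apply: sqr_le => // x; exact: ltW.
  have hgoo : (\int[nu]_x ((hR x * g x) ^+ 2)%:E < +oo)%E.
    apply: (sqr_le (fun x => hR x * g x)) => //; first exact: measurable_funM.
    by move=> x; rewrite mulr_ge0// ltW.
  pose f x := w x * (g x)%:C%C.
  have fL2 : L2 mu f by exact: wL2.
  have hfL2 : L2 mu (app (mult_op mu h) f).
    have -> : app (mult_op mu h) f = (fun x => w x * (hR x * g x)%:C%C).
      by apply/funext => x; rewrite /= /f mulrCA -rmorphM.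
    by apply: wL2 => //; exact: measurable_funM.
  have [_ PMf] : dom (op_comp (mult_op mu h) P) f /\
      \forall x \ae mu, app (op_comp P (mult_op mu h)) f x =
                        app (op_comp (mult_op mu h) P) f x.
    by apply: PM.
  have [eR _] := ccondexpP fL2.
  have [[mR2 _] _] := ccondexpP hfL2.
  apply: (rcondexp_ratio (h := hR) mphi mkappa kappa0 kappa1 ikappa _ _ _ _ eR mR2).
  + exact: (cmeasurable_wquot mw fL2.1).1.
  + exact: hR0.
  + apply/ae_wmeasureP; apply: aeW => x w0.
    by rewrite /wquot w0 /f mulrAC divff// mul1r; exact: g0.
  + apply: Re_sqr_lty; first exact: cmeasurable_wquot mw fL2.1.
    exact: wquot_norm_lty.
  + apply/ae_wmeasureP; apply: filterS PMf => x /= PMx w0.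
    rewrite -complex_ReMl; congr complex.Re; apply: (mulfI w0).
    by rewrite PMx mulrCA.
- move=> f [[fL2 hfL2'] _].
  have hfL2 : L2 mu (app (mult_op mu h) f) by exact: hfL2'.
  have PfL2 := proj_L2 fL2; have PhfL2 := proj_L2 hfL2.
  have mq := cmeasurable_wquot mw fL2.1; have qoo := wquot_norm_lty fL2.
  have mhq : cmeasurable (wquot w (app (mult_op mu h) f)).
    exact: cmeasurable_wquot mw hfL2.1.
  have hqoo := wquot_norm_lty hfL2.
  have [eR eI] := ccondexpP fL2; have [heR heI] := ccondexpP hfL2.
  have Rhoo := Re_sqr_lty mhq hqoo; have Ihoo := Im_sqr_lty mhq hqoo.
  have RM : (fun x => complex.Re (wquot w (app (mult_op mu h) f) x)) =
      (fun x => hR x * complex.Re (wquot w f x)).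
    by apply/funext => x; rewrite quotM complex_ReMl.
  have IM : (fun x => complex.Im (wquot w (app (mult_op mu h) f) x)) =
      (fun x => hR x * complex.Im (wquot w f x)).
    by apply/funext => x; rewrite quotM complex_ImMl.
  have aeR := rcondexp_mul mphi mkappa kappa0 kappa1 ikappa.
  have Eae : \forall x \ae nu,
      E (app (mult_op mu h) f) x = (hR x)%:C%C * E f x.
    have Rae : \forall x \ae nu, complex.Re (E (app (mult_op mu h) f) x) =
        a x * complex.Re (E f x).
      apply: (aeR _ hR a _ _ mq.1 mhR (Re_sqr_lty mq qoo) _ ma a0 ha eR).
      - rewrite (eq_integral (fun x =>
          (complex.Re (wquot w (app (mult_op mu h) f) x) ^+ 2)%:E))// => x _.
        by rewrite quotM complex_ReMl.
      - by rewrite -RM.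
    have Iae : \forall x \ae nu, complex.Im (E (app (mult_op mu h) f) x) =
        a x * complex.Im (E f x).
      apply: (aeR _ hR a _ _ mq.2 mhR (Im_sqr_lty mq qoo) _ ma a0 ha eI).
      - rewrite (eq_integral (fun x =>
          (complex.Im (wquot w (app (mult_op mu h) f) x) ^+ 2)%:E))// => x _.
        by rewrite quotM complex_ImMl.
      - by rewrite -IM.
    apply: filterS3 ha Rae Iae => x hax Rx Ix.
    apply/eqP; rewrite eq_complex complex_ReMl complex_ImMl -[hR x]/(fine (h x)) hax -Rx -Ix.
    by rewrite !eqxx.
  have PM : \forall x \ae mu, app (op_comp P (mult_op mu h)) f x =
                              app (op_comp (mult_op mu h) P) f x.
    move/ae_wmeasureP : Eae; apply: filterS => x Ex /=.
    have [->|w0] := eqVneq (w x) 0; first by rewrite !mul0r mulr0.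
    by rewrite Ex// mulrCA.
  split => //; split => //; split => //.
  apply: L2_ae_eq PhfL2 PM.
  by apply: cmeasurableM => //; exact: PfL2.1.
Qed.

End projection_commutation.

(** * Consequences of the density of the domains *)

Section density.
Context d (X : measurableType d) (R : realType).
Variable mu : {sigma_finite_measure set X -> \bar R}.

(** The elements of a dense domain that approximate a function k0 > 0 of L^2
    cannot all vanish on a set of positive measure. *)
Lemma dense_domain_witness (A : operator X R) :
  densely_defined mu A -> (forall f, dom A f -> L2 mu f) ->
  exists g : nat -> X -> R[i], (forall k, dom A (g k)) /\
    \forall x \ae mu, exists k, g k x != 0.
Proof.
move=> dA domL2.
have [F FT mFoo] := sigma_finiteT mu.
have [k0 [mk0 k0pos k0le ik0]] : exists k0 : X -> R,
    [/\ measurable_fun [set: X] k0, forall x, 0 < k0 x, forall x, k0 x <= 1 &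
    (\int[mu]_x (k0 x)%:E < +oo)%E].
  apply: (@exists_integrable_weight _ _ _ mu (fun k => \1_(F k))).
  - by move=> k; apply: measurable_indic; exact: (mFoo k).1.
  - by move=> k x; rewrite indicE.
  - move=> k; rewrite integral_indic//; last exact: (mFoo k).1.
    by rewrite setIT; exact: (mFoo k).2.
  - move=> x; have : [set: X] x by [].
    rewrite FT => -[k _ Fx]; exists k.
    by rewrite indicE mem_set.
pose f0 x := (k0 x)%:C%C.
have f0E x : Normc.normc (f0 x) ^+ 2 = k0 x ^+ 2.
  by rewrite Defs.normcE /= expr0n addr0.
have f0L2 : L2 mu f0.
  apply/L2P; split; first exact: cmeasurable_real.
  under eq_integral do rewrite f0E.
  apply: le_lt_trans ik0; apply: ge0_integral_ler => //.
  - exact: measurable_funX.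
  - by move=> x; exact: sqr_ge0.
  - by move=> x; rewrite expr2 ler_piMl// ltW.
have /choice[g gP] : forall k : nat, exists g : X -> R[i], dom A g /\
    (L2norm mu (fun x => f0 x - g x)%R < (k.+1%:R^-1)%:E)%E.
  by move=> k; apply: dA => //; rewrite invr_gt0.
exists g; split; first by move=> k; exact: (gP k).1.
have mg k : cmeasurable (g k) by have [/domL2 []] := gP k.
(* Each g k differs from k0 by k0 itself on the common zero set Z. *)
pose Z := \bigcap_k [set x | Normc.normc (g k x) ^+ 2 == 0].
have mZ : measurable Z.
  apply: bigcap_measurable => // k _.
  have := measurable_fun_eqr (cmeasurable_normc2 (mg k))
    (@measurable_cst _ _ X _ setT (0 : R)).
  by move=> /(_ measurableT [set true]); rewrite setTI; apply.
have IZ : (\int[mu]_(x in Z) (k0 x ^+ 2)%:E = 0)%E.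
  apply/eqP; rewrite eq_le; apply/andP; split; last first.
    by apply: integral_ge0 => x _; rewrite lee_fin sqr_ge0.
  apply/lee_addgt0Pr => e e0; rewrite add0e.
  pose k := Num.truncn e^-1.
  have ke : k.+1%:R^-1 <= e :> R.
    by rewrite invf_ple ?posrE//; apply/ltW; exact: truncnS_gt.
  have k1 : k.+1%:R^-1 <= 1 :> R by rewrite invf_le1// ler1n.
  have kp : 0 <= k.+1%:R^-1 :> R by rewrite invr_ge0.
  apply: (@le_trans _ _ (k.+1%:R^-1 ^+ 2)%:E); last first.
    by rewrite lee_fin; apply: le_trans ke; rewrite expr2 ler_piMl.
  have [_ /ltW gk] := gP k.
  have : (L2norm mu (fun x => f0 x - g k x)%R `^ 2 <= (k.+1%:R^-1)%:E `^ 2)%E.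
    apply: gt0_ler_poweR => //.
    - by rewrite in_itv/= leey andbT; exact: Lnorm_ge0.
    - by rewrite in_itv/= leey andbT lee_fin.
  rewrite L2norm_sqr poweR_EFin powR_mulrn//.
  apply: le_trans.
  have mfg : measurable_fun [set: X] (fun x => Normc.normc (f0 x - g k x) ^+ 2).
    apply: cmeasurable_normc2; by apply: (@cmeasurableB _ _ _ f0 (g k)).
  apply: (@le_trans _ _ (\int[mu]_(x in Z) (Normc.normc (f0 x - g k x) ^+ 2)%:E)%E).
    rewrite (eq_integral (fun x => (Normc.normc (f0 x - g k x) ^+ 2)%:E))// => x.
    rewrite inE => /(_ k I) /=; rewrite sqrf_eq0 => /eqP/Normc.eq0_normc ->.
    by rewrite subr0 f0E.
  apply: ge0_subset_integral => //.
  - exact/measurable_EFinP.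
  - by move=> x _; rewrite lee_fin sqr_ge0.
have muZ : mu Z = 0%E.
  have : ae_eq mu Z (fun x => (k0 x ^+ 2)%:E) (cst 0%E).
    apply/ae_eq_integral_abs => //.
      by apply/measurable_EFinP; apply: measurable_funTS; exact: measurable_funX.
    rewrite -[RHS]IZ; apply: eq_integral => x _.
    by rewrite gee0_abs// lee_fin sqr_ge0.
  move=> [N [mN N0 ZN]]; apply/eqP; rewrite -measure_le0 -N0.
  apply: le_measure; rewrite ?inE// => x Zx; apply: ZN => /= /(_ Zx) k00.
  have : k0 x ^+ 2 = 0 := EFin_inj k00.
  by apply/eqP; rewrite gt_eqF// exprn_gt0.
exists Z; split => // x /= ng k _ /=.
apply/eqP; have [->|gx] := eqVneq (g k x) 0; first by rewrite Normc.normc0 expr0n.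
by exfalso; apply: ng; exists k.
Qed.

(** The integral of |g|^2 h is that of |u|^2 |g o psi|^2, finite for g in the
    domain; so h is finite a.e. where g does not vanish. *)
Lemma hRN_measurable_fin (psi : X -> X) (u : X -> R[i]) (A : operator X R) :
  measurable_fun [set: X] psi -> cmeasurable u ->
  densely_defined mu A ->
  (forall f, dom A f -> L2 mu f /\ L2 mu (fun x => u x * f (psi x))) ->
  [/\ measurable_fun [set: X] (hRN mu psi u),
      forall x, (0 <= hRN mu psi u x)%E &
      \forall x \ae mu, hRN mu psi u x \is a fin_num].
Proof.
move=> mpsi mu' dA domA; rewrite /hRN.
(* If there is no Radon-Nikodym derivative, the chosen function is 0 and all
   three properties are clear. *)
case: xgetP => [h _ [mh h0 hE]|_]; last first.
  by split => //; apply: aeW.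
split => //.
have [g [gdom gae]] := dense_domain_witness dA (fun f fA => (domA f fA).1).
have mg k : measurable_fun [set: X] (fun x => Normc.normc (g k x) ^+ 2).
  by apply: cmeasurable_normc2; exact: (domA _ (gdom k)).1.1.
have mu2 := cmeasurable_normc2 mu'.
have gh k : \forall x \ae mu, ((Normc.normc (g k x) ^+ 2)%:E * h x)%E \is a fin_num.
  have mgh : measurable_fun [set: X] (fun x => (Normc.normc (g k x) ^+ 2)%:E * h x)%E.
    by apply: emeasurable_funM => //; exact/measurable_EFinP.
  have [_ /L2P[_ goo]] := domA _ (gdom k).
  have igh : mu.-integrable [set: X] (fun x => (Normc.normc (g k x) ^+ 2)%:E * h x)%E.
    apply/integrableP; split => //.
    under eq_integral do rewrite gee0_abs ?mule_ge0 ?lee_fin ?sqr_ge0//.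
    rewrite (_ : (\int[mu]_x ((Normc.normc (g k x) ^+ 2)%:E * h x))%E =
      (\int[mu]_x (Normc.normc (u x * g k (psi x)) ^+ 2)%:E)%E)//.
    pose G : X -> \bar R := fun y => (Normc.normc (g k y) ^+ 2)%:E.
    transitivity (\int[mu]_x (G (psi x) * (Normc.normc (u x) ^+ 2)%:E))%E.
      apply: (@integral_weighted_transfer _ X R _ _ X X mu mu id psi h _ G) => //.
      - exact/measurable_EFinP.
      - by move=> x; rewrite lee_fin sqr_ge0.
      - by move=> B mB; rewrite -[LHS]hE.
      - exact/measurable_EFinP.
      - by move=> y; rewrite lee_fin sqr_ge0.
    by apply: eq_integral => x _; rewrite /= -EFinM normc2M mulrC.
  by have := integrable_ae measurableT igh; apply: filterS => x; exact.
have := ae_foralln gh; apply: filterS2 gae => x [k gk] /(_ k).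
have := h0 x; case: (h x) => // _.
by rewrite gt0_muley ?lte_fin ?normc2_gt0.
Qed.

(** For g in the domain, |g|^2 is integrable for the image of |w|^2 mu under
    phi; the series of these functions gives kappa. *)
Lemma pushforward_weight (phi : X -> X) (w : X -> R[i]) (mw : cmeasurable w)
    (A : operator X R) :
  measurable_fun [set: X] phi -> wcomp_well_defined mu phi w ->
  densely_defined mu A ->
  (forall f, dom A f -> L2 mu f /\ L2 mu (fun x => w x * f (phi x))) ->
  exists kappa : X -> R, [/\ measurable_fun [set: X] kappa,
    forall x, 0 < kappa x, forall x, kappa x <= 1 &
    (\int[wmeasure mu mw]_x (kappa (phi x))%:E < +oo)%E].
Proof.
move=> mphi wd dA domA; have mw2 := cmeasurable_normc2 mw.
have w20 x : 0 <= Normc.normc (w x) ^+ 2 by exact: sqr_ge0.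
have mw2E : measurable_fun [set: X] (fun x => (Normc.normc (w x) ^+ 2)%:E).
  exact/measurable_EFinP.
have [la laE] := image_density_measure mu mphi mw2E (fun x => w20 x).
have la_int (k : X -> R) : measurable_fun [set: X] k -> (forall x, 0 <= k x) ->
    (\int[la]_x (k x)%:E = \int[mu]_x (k (phi x) * Normc.normc (w x) ^+ 2)%:E)%E.
  by move=> mk k0; apply: (integral_image_density mphi) => // B _; exact: laE.
have [g [gdom [N [mN N0 gN]]]] := dense_domain_witness dA (fun f fA => (domA f fA).1).
have mg k : measurable_fun [set: X] (fun x => Normc.normc (g k x) ^+ 2).
  by apply: cmeasurable_normc2; exact: (domA _ (gdom k)).1.1.
have laN : la N = 0%E.
  by rewrite laE; move/null_content_dominatesP : wd; apply.
(* The functions |g_k|^2 have no common zero outside N, and the indicator of N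
   has integral 0 since the image measure is dominated by mu. *)
pose v k : X -> R :=
  if k is k'.+1 then (fun x => Normc.normc (g k' x) ^+ 2) else \1_N.
have [kappa [mk k0 k1 ik]] : exists kappa : X -> R,
    [/\ measurable_fun [set: X] kappa, forall x, 0 < kappa x,
        forall x, kappa x <= 1 & (\int[la]_x (kappa x)%:E < +oo)%E].
  apply: (@exists_integrable_weight _ _ _ la v).
  - by case=> [|k]; [exact: measurable_indic|exact: mg].
  - by case=> [|k] x /=; rewrite ?sqr_ge0// indicE.
  - case=> [|k] /=.
      by rewrite integral_indic// setIT laN.
    rewrite la_int//; last by move=> x; exact: sqr_ge0.
    have [_ /L2P[_]] := domA _ (gdom k).
    by under eq_integral do rewrite normc2M mulrC.
  - move=> x; have [Nx|nNx] := pselect (N x).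
      by exists 0%N; rewrite /= indicE mem_set.
    have [k gk] : exists k, g k x != 0.
      by apply: contrapT => /gN.
    by exists k.+1; exact: normc2_gt0.
exists kappa; split => //.
rewrite integral_wmeasure//.
- by rewrite -la_int// => x; exact: ltW.
- exact: measurableT_comp.
- by move=> x; exact: ltW.
Qed.

End density.

(** * Powers of the weighted composition operator *)

Section powers.
Context d (X : measurableType d) (R : realType) (mu : {measure set X -> \bar R}).
Variables (phi : X -> X) (w : X -> R[i]).
Local Notation C := (wcomp_op mu phi w).

Lemma app_op_pow n f x :
  app (op_pow mu C n) f x = wprod phi w n x * f (iter n phi x).
Proof.
elim: n x => [|n IHn] x; first by rewrite /wprod big_ord0 mul1r.
rewrite iterSr [LHS]/= -/(op_pow mu C n) IHn mulrA; congr (_ * _).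
rewrite /wprod big_ord_recl /=; congr (_ * _).
by apply: eq_bigr => i _; rewrite -iterSr.
Qed.

Lemma dom_op_pow n f : dom (op_pow mu C n) f ->
  L2 mu f /\ L2 mu (fun x => wprod phi w n x * f (iter n phi x)).
Proof.
have appE m : (fun x => wprod phi w m x * f (iter m phi x)) =
    app (op_pow mu C m) f.
  by apply/funext => x; rewrite app_op_pow.
rewrite appE; elim: n => [//|n IHn] [/IHn[fL2 _] [_ fnL2]].
by split.
Qed.

Hypothesis mphi : measurable_fun [set: X] phi.
Hypothesis mw : cmeasurable w.

Lemma measurable_iter n : measurable_fun [set: X] (iter n phi).
Proof.
elim: n => [|n IHn]; first exact: measurable_id.
exact: (measurableT_comp mphi IHn).
Qed.

Lemma cmeasurable_wprod n : cmeasurable (wprod phi w n).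
Proof.
elim: n => [|n IHn].
  have -> : wprod phi w 0 = (fun x => (cst 1 x)%:C%C).
    by apply/funext => x; rewrite /wprod big_ord0.
  exact: cmeasurable_real.
have -> : wprod phi w n.+1 = (fun x => wprod phi w n x * w (iter n phi x)).
  by apply/funext => x; rewrite /wprod big_ord_recr.
apply: cmeasurableM => //; apply: (cmeasurable_comp _ mw).
exact: measurable_iter.
Qed.

End powers.

Theorem theorem4 (d : measure_display) (X : measurableType d) (R : realType)
    (mu : {sigma_finite_measure set X -> \bar R})
    (phi : X -> X) (w : X -> R[i])
    (mphi : measurable_fun [set: X] phi) (mw : cmeasurable w)
    (wd : wcomp_well_defined mu phi w)
    (hi : forall n : nat, (0 < n)%N ->
       densely_defined mu (op_pow mu (wcomp_op mu phi w) n) /\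
       closed_op mu (op_pow mu (wcomp_op mu phi w) n)) :
  let h (n : nat) := hRN mu (iter n phi) (wprod phi w n) in
  let P := proj_op mu phi mw in
  (forall n : nat, (0 < n)%N ->
     op_le mu (op_comp P (mult_op mu (h n))) (op_comp (mult_op mu (h n)) P))
  <->
  (forall n : nat, (0 < n)%N ->
     \forall x \ae (wmeasure mu mw),
       condexp (wmeasure mu mw) phi (h n) x = h n x).
Proof.
move=> h P.
have w1 : wprod phi w 1 = w.
  by apply/funext => x; rewrite /wprod big_ord_recl big_ord0 mulr1.
have [|kappa [mk k0 k1 ik]] := pushforward_weight mw mphi wd (hi 1%N isT).1.
  by move=> f /dom_op_pow; rewrite w1.
suff nth n : (0 < n)%N ->
    op_le mu (op_comp P (mult_op mu (h n))) (op_comp (mult_op mu (h n)) P) <->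
    \forall x \ae (wmeasure mu mw), condexp (wmeasure mu mw) phi (h n) x = h n x.
  by split=> H n n0; apply/(nth n n0)/H.
move=> n0.
have [mh h0 hfin] := hRN_measurable_fin (measurable_iter mphi n)
  (cmeasurable_wprod mphi mw n) (hi n n0).1 (@dom_op_pow _ _ _ _ phi w n).
apply: (proj_commutes_iff mphi mk k0 k1 ik mh h0 _).
by apply/ae_wmeasureP; apply: filterS hfin.
Qed.
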